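(* Let $r\in\mathbb{N}$, let $f$ be $r$-times differentiable, and let $a,b\in\mathbb{R}$. Then $$\int f(q)\,\zeta(z,a+bq)\,dq=\sum_{k=1}^{r}(-1)^{k+1}\frac{f^{(k-1)}(q)\,\zeta(z-k,a+bq)}{b^{k}\,(1-z)_{k}}+\frac{(-1)^{r}}{b^{r}(1-z)_{r}}\int f^{(r)}(q)\,\zeta(z-r,a+bq)\,dq .$$
   Context: $\mathbb{N}=\{1,2,3,\dots\}$. $\zeta(z,q)$ is the Hurwitz zeta function, defined by $\zeta(z,q)=\sum_{n=0}^{\infty}\frac{1}{(n+q)^{z}}$ for $z\in\mathbb{C}$, $\operatorname{Re} z>1$ and $q\neq 0,-1,-2,\dots$, and extended analytically in $z$ to the whole complex plane except for a simple pole at $z=1$. $(x)_k=x(x+1)\cdots(x+k-1)$ is the Pochhammer symbol. $f^{(j)}$ is the $j$-th derivative of $f$ with respect to $q$, with $f^{(0)}=f$. The integrals are indefinite integrals (primitives) in the variable $q$, so the identity is understood up to an additive constant of integration. *)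

(* Defs.v *)
From Stdlib Require Import Reals ClassicalEpsilon.
From Coquelicot Require Import Coquelicot.
Open Scope R_scope.

Definition Cexp (w : C) : C :=
  (exp (Re w) * cos (Im w), exp (Re w) * sin (Im w)).

(* Principal argument, with values in (-PI, PI]. *)
Definition Carg (w : C) : R :=
  if Rle_dec 0 (Im w) then acos (Re w / Cmod w) else - acos (Re w / Cmod w).

Definition Clog (w : C) : C := (ln (Cmod w), Carg w).

(* Principal value of w ^ s, meaningful for w <> 0. *)
Definition Cpower (w s : C) : C := Cexp (s * Clog w)%C.

Definition analytic_at (F : C -> C) (z0 : C) : Prop :=
  exists a : nat -> C,
    locally z0 (fun z => is_pseries (K := C_AbsRing) (V := C_NormedModule)
                           a (z - z0)%C (F z)).

Definition simple_pole_at (F : C -> C) (z0 : C) : Prop :=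
  exists c : C, c <> RtoC 0 /\
    filterlim (fun z => ((z - z0) * F z)%C) (locally' z0) (locally c).

(* Z is the function z |-> zeta(z, q); its value at the pole z = 1 is
   unconstrained. *)
Definition is_hurwitz_zeta (q : C) (Z : C -> C) : Prop :=
  (forall z : C, 1 < Re z ->
     is_series (K := C_AbsRing) (V := C_NormedModule)
       (fun n : nat => (1 / Cpower (INR n + q) z)%C) (Z z)) /\
  (forall z : C, z <> RtoC 1 -> analytic_at Z z) /\
  simple_pole_at Z (RtoC 1).

(* For q not in {0, -1, -2, ...} the predicate determines the function away
   from z = 1; the values at z = 1 and at excluded q are arbitrary. *)
Definition hurwitz_zeta (z q : C) : C :=
  epsilon (inhabits (fun _ : C => RtoC 0)) (is_hurwitz_zeta q) z.

Fixpoint pochhammer (x : C) (k : nat) : C :=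
  match k with
  | O => RtoC 1
  | S j => (pochhammer x j * (x + INR j))%C
  end.

(* Derivatives of complex-valued functions of a real variable. *)
Definition RC_derive (f : R -> C) (q : R) : C :=
  (Derive (fun t => Re (f t)) q, Derive (fun t => Im (f t)) q).

Fixpoint RC_derive_n (f : R -> C) (j : nat) : R -> C :=
  match j with
  | O => f
  | S i => RC_derive (RC_derive_n f i)
  end.

Definition in_open_interval (lo hi : Rbar) (q : R) : Prop :=
  Rbar_lt lo q /\ Rbar_lt q hi.

Definition times_differentiable_on (lo hi : Rbar) (r : nat) (f : R -> C) : Prop :=
  forall j : nat, (j < r)%nat -> forall q : R, in_open_interval lo hi q ->
    ex_derive (K := R_AbsRing) (V := C_R_NormedModule) (RC_derive_n f j) q.

Definition is_primitive_on (lo hi : Rbar) (F g : R -> C) : Prop :=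
  forall q : R, in_open_interval lo hi q ->
    is_derive (K := R_AbsRing) (V := C_R_NormedModule) F q (g q).

(* Main.v *)
Require Import Defs.
From Stdlib Require Import Reals Lra Lia ZArith Factorial Classical ClassicalEpsilon.
From Coquelicot Require Import Coquelicot.
Open Scope R_scope.

(* The identity is repeated integration by parts, based on
   d/dq zeta(s, q) = - s zeta(s + 1, q); the work lies in this formula for the analytically
   continued zeta function.  For q > 1 the function E(s, q) = (s - 1) zeta(s, q) is entire in s and
   satisfies E(s, q) = q^(1-s) + (s - 1) * integral_q^(q+1) (q + 1 - x) E(s + 1, x) dx, which extends
   E from Re s > c to Re s > c - 1 and preserves both analyticity in s and the relation
   dE/dq (s, q) = - (s - 1) E(s + 1, q).  Analyticity is carried along as a power series in s whose
   coefficients depend continuously on q, so no Cauchy theory is needed.  A real q below 1 is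
   reduced to q > 1 by splitting off finitely many terms of the series.  Since [hurwitz_zeta] is
   chosen by [epsilon], it is identified with this construction by the identity theorem, applied
   along a segment which avoids the pole. *)

(** * Calculus of complex functions of a real variable *)

(** The continuation formula comes from two facts about [h(x) = (s - 1) zeta(s, x)] in the
    half-plane of convergence. Its integral over [[q, q + 1]] telescopes to [q^(1-s)], and
    integration by parts turns that integral into [h(q)] plus the integral of [(q + 1 - x) h'(x)].
    As [h'] is [- (s - 1) E(s + 1, x)], this expresses [E(s, q)] through values at [s + 1], which
    makes sense one unit further left. The condition [q > 1] keeps [ln q] positive, so that the
    bounds on the terms [(n + q)^(-s)] are uniform down to the end of the interval. Infinite sums
    are never differentiated in [q]: they are integrated termwise under a uniform tail estimate, and
    the derivative is then read off from a primitive. A separate obstacle lies in the final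
    integral: [f^(r)] exists but may be discontinuous, so a primitive of the last integrand cannot
    be produced as a Riemann integral of a continuous function. It is obtained from the identity
    itself. *)

Notation is_RC_derive := (is_derive (K := R_AbsRing) (V := C_R_NormedModule)).
Notation is_Cseries := (is_series (K := C_AbsRing) (V := C_NormedModule)).

Lemma C_ext (u v : C) : Re u = Re v -> Im u = Im v -> u = v.
Proof. destruct u, v; simpl; congruence. Qed.

Lemma im_le_Cmod (c : C) : Rabs (Im c) <= Cmod c.
Proof.
  apply Rle_trans with (2 := Rmax_Cmod c). apply Rmax_r.
Qed.

Lemma is_RC_derive_iff (F : R -> C) (q : R) (l : C) :
  is_RC_derive F q l <->
  is_derive (fun t => Re (F t)) q (Re l) /\ is_derive (fun t => Im (F t)) q (Im l).
Proof.
  split.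
  - intros H; split.
    + apply (filterdiff_comp' (U := R_NormedModule) (V := C_R_NormedModule) (W := R_NormedModule)
               F (fun z : C => Re z) q _ (fun z : C => Re z) H).
      apply filterdiff_linear. apply (is_linear_fst (K := R_AbsRing) (U := R_NormedModule) (V := R_NormedModule)).
    + apply (filterdiff_comp' (U := R_NormedModule) (V := C_R_NormedModule) (W := R_NormedModule)
               F (fun z : C => Im z) q _ (fun z : C => Im z) H).
      apply filterdiff_linear. apply (is_linear_snd (K := R_AbsRing) (U := R_NormedModule) (V := R_NormedModule)).
  - intros [H1 H2].
    apply (filterdiff_ext (K := R_AbsRing) (U := R_NormedModule) (V := C_R_NormedModule)
             (fun t => (Re (F t), Im (F t)))).
    { intros y; now destruct (F y). }
    refine (filterdiff_ext_lin _ _ _ (@filterdiff_comp'_2 R_AbsRing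
      R_NormedModule R_NormedModule R_NormedModule C_R_NormedModule
      (fun t => Re (F t)) (fun t => Im (F t)) (fun a b : R => (a, b)) q _ _
      (fun a b : R => (a, b)) H1 H2 _) _).
    (* The pairing map is the identity up to eta, hence its own differential. *)
    + apply filterdiff_ext_lin with (fun t : R * R => t).
      * apply (filterdiff_ext_locally (K := R_AbsRing) (U := C_R_NormedModule) (V := C_R_NormedModule) (fun t => t)).
        -- apply filter_forall; now intros [].
        -- apply filterdiff_id.
      * now intros [].
    + intros y; simpl. now destruct l.
Qed.

Lemma is_derive_Rcontinuous (f : R -> R) (x l : R) : is_derive f x l -> continuous f x.
Proof.
  intros H. apply (ex_derive_continuous (K := R_AbsRing) (V := R_NormedModule)).
  now exists l.
Qed.

Lemma is_derive_Rmult (f g : R -> R) (x l m : R) :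
  is_derive f x l -> is_derive g x m ->
  is_derive (fun t => f t * g t) x (l * g x + f x * m).
Proof. rewrite !is_derive_Reals. apply derivable_pt_lim_mult. Qed.

Lemma is_derive_Rplus (f g : R -> R) (x l m : R) :
  is_derive f x l -> is_derive g x m -> is_derive (fun t => f t + g t) x (l + m).
Proof. rewrite !is_derive_Reals. apply derivable_pt_lim_plus. Qed.

Lemma is_derive_Rminus (f g : R -> R) (x l m : R) :
  is_derive f x l -> is_derive g x m -> is_derive (fun t => f t - g t) x (l - m).
Proof. rewrite !is_derive_Reals. apply derivable_pt_lim_minus. Qed.

Lemma is_RC_derive_mult (F G : R -> C) (q : R) (l m : C) :
  is_RC_derive F q l -> is_RC_derive G q m ->
  is_RC_derive (fun t => F t * G t)%C q (l * G q + F q * m)%C.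
Proof.
  intros HF HG. apply is_RC_derive_iff in HF as [H1 H2]. apply is_RC_derive_iff in HG as [H3 H4].
  apply is_RC_derive_iff; split.
  - replace (Re (l * G q + F q * m)%C) with
      ((Re l * Re (G q) + Re (F q) * Re m) - (Im l * Im (G q) + Im (F q) * Im m))
      by (unfold Re, Im; simpl; ring).
    exact (is_derive_Rminus _ _ _ _ _ (is_derive_Rmult _ _ _ _ _ H1 H3) (is_derive_Rmult _ _ _ _ _ H2 H4)).
  - replace (Im (l * G q + F q * m)%C) with
      ((Re l * Im (G q) + Re (F q) * Im m) + (Im l * Re (G q) + Im (F q) * Re m))
      by (unfold Re, Im; simpl; ring).
    exact (is_derive_Rplus _ _ _ _ _ (is_derive_Rmult _ _ _ _ _ H1 H4) (is_derive_Rmult _ _ _ _ _ H2 H3)).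
Qed.

Lemma is_RC_derive_const (c : C) (q : R) : is_RC_derive (fun _ => c) q (RtoC 0).
Proof. apply (is_derive_const (K := R_AbsRing) (V := C_R_NormedModule)). Qed.

Lemma is_RC_derive_eq (F : R -> C) (q : R) (l m : C) :
  is_RC_derive F q l -> l = m -> is_RC_derive F q m.
Proof. now intros H <-. Qed.

Lemma is_RC_derive_ext (F G : R -> C) (q : R) (l : C) :
  (forall t, F t = G t) -> is_RC_derive F q l -> is_RC_derive G q l.
Proof. exact (is_derive_ext (K := R_AbsRing) (V := C_R_NormedModule) F G q l). Qed.

Lemma is_RC_derive_ext_loc (F G : R -> C) (q : R) (l : C) :
  locally q (fun t => F t = G t) -> is_RC_derive F q l -> is_RC_derive G q l.
Proof. exact (is_derive_ext_loc (K := R_AbsRing) (V := C_R_NormedModule) F G q l). Qed.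

Lemma is_RC_derive_cmult (c : C) (F : R -> C) (q : R) (l : C) :
  is_RC_derive F q l -> is_RC_derive (fun t => c * F t)%C q (c * l)%C.
Proof.
  intros H. apply (is_RC_derive_eq _ _ _ _ (is_RC_derive_mult _ _ _ _ _ (is_RC_derive_const c q) H)).
  ring.
Qed.

Lemma is_RC_derive_plus (F G : R -> C) (q : R) (l m : C) :
  is_RC_derive F q l -> is_RC_derive G q m ->
  is_RC_derive (fun t => F t + G t)%C q (l + m)%C.
Proof.
  intros HF HG. apply is_RC_derive_iff in HF as [H1 H2]. apply is_RC_derive_iff in HG as [H3 H4].
  apply is_RC_derive_iff; split.
  - exact (is_derive_Rplus _ _ _ _ _ H1 H3).
  - exact (is_derive_Rplus _ _ _ _ _ H2 H4).
Qed.

Lemma is_RC_derive_minus (F G : R -> C) (q : R) (l m : C) :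
  is_RC_derive F q l -> is_RC_derive G q m ->
  is_RC_derive (fun t => F t - G t)%C q (l - m)%C.
Proof.
  intros HF HG. apply is_RC_derive_iff in HF as [H1 H2]. apply is_RC_derive_iff in HG as [H3 H4].
  apply is_RC_derive_iff; split.
  - exact (is_derive_Rminus _ _ _ _ _ H1 H3).
  - exact (is_derive_Rminus _ _ _ _ _ H2 H4).
Qed.

Lemma is_RC_derive_comp_affine (F : R -> C) (a b q : R) (l : C) :
  is_RC_derive F (a + b * q) l ->
  is_RC_derive (fun t => F (a + b * t)) q (RtoC b * l)%C.
Proof.
  intros H. evar_last.
  apply (is_derive_comp F (fun t => a + b * t)). apply H.
  instantiate (1 := b). auto_derive; trivial; ring.
  apply C_ext; unfold scal; simpl; unfold prod_scal, scal; simpl; unfold mult; simpl; ring.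
Qed.

(** Stated on the two components because the integrals below are real Riemann integrals of the
    components. *)
Definition RC_continuous (g : R -> C) (q : R) : Prop :=
  continuous (fun t => Re (g t)) q /\ continuous (fun t => Im (g t)) q.

Lemma is_RC_derive_continuous (F : R -> C) (q : R) (l : C) :
  is_RC_derive F q l -> RC_continuous F q.
Proof.
  intros H. apply is_RC_derive_iff in H as [H1 H2].
  split; [eapply is_derive_Rcontinuous, H1 | eapply is_derive_Rcontinuous, H2].
Qed.

Lemma RC_continuous_mult (F G : R -> C) (q : R) :
  RC_continuous F q -> RC_continuous G q -> RC_continuous (fun t => F t * G t)%C q.
Proof.
  intros [H1 H2] [H3 H4]; split; simpl.
  - apply (continuous_minus (V := R_NormedModule)); apply (continuous_mult (K := R_AbsRing)); assumption.
  - apply (continuous_plus (V := R_NormedModule)); apply (continuous_mult (K := R_AbsRing)); assumption.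
Qed.

Lemma RC_continuous_plus (F G : R -> C) (q : R) :
  RC_continuous F q -> RC_continuous G q -> RC_continuous (fun t => F t + G t)%C q.
Proof.
  intros [H1 H2] [H3 H4]; split; simpl; apply (continuous_plus (V := R_NormedModule)); assumption.
Qed.

Lemma RC_continuous_const (c : C) (q : R) : RC_continuous (fun _ => c) q.
Proof. split; apply continuous_const. Qed.

Lemma in_open_interval_between (lo hi : Rbar) (x y t : R) :
  in_open_interval lo hi x -> in_open_interval lo hi y ->
  Rmin x y <= t <= Rmax x y -> in_open_interval lo hi t.
Proof.
  unfold in_open_interval, Rmin, Rmax. destruct lo, hi; simpl; destruct Rle_dec; intuition lra.
Qed.

Lemma in_open_interval_locally (lo hi : Rbar) (q : R) :
  in_open_interval lo hi q -> locally q (in_open_interval lo hi).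
Proof.
  intros [H1 H2]. apply filter_and.
  - apply (open_Rbar_gt' q lo H1).
  - apply (open_Rbar_lt' q hi H2).
Qed.

(** The comparison function [h] is general because the remainder of the exponential series needs a
    bound that grows like a power of [t]. *)
Lemma RC_mean_value (F dF : R -> C) (h dh : R -> R) (x y : R) :
  x <= y ->
  (forall t, x <= t <= y -> is_RC_derive F t (dF t)) ->
  (forall t, x <= t <= y -> is_derive h t (dh t)) ->
  (forall t, x <= t <= y -> Cmod (dF t) <= dh t) ->
  Cmod (F y - F x) <= h y - h x.
Proof.
  intros Hxy HF Hh Hb.
  set (D := (F y - F x)%C).
  (* Project on the direction of the increment. *)
  pose (phi := fun t => Re (Cconj D * F t) - Cmod D * h t).
  pose (dphi := fun t => Re (Cconj D * dF t) - Cmod D * dh t).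
  assert (Hphi : forall t, x <= t <= y -> is_derive phi t (dphi t)).
  { intros t Ht. apply is_derive_Rminus.
    - exact (proj1 (proj1 (is_RC_derive_iff _ _ _) (is_RC_derive_cmult (Cconj D) _ _ _ (HF t Ht)))).
    - apply is_derive_scal, Hh, Ht. }
  destruct (MVT_gen phi x y dphi) as [c [Hc Ec]].
  - rewrite Rmin_left, Rmax_right by lra. intros t Ht. apply Hphi; lra.
  - rewrite Rmin_left, Rmax_right by lra. intros t Ht.
    apply continuity_pt_filterlim. eapply is_derive_Rcontinuous, Hphi; lra.
  - rewrite Rmin_left, Rmax_right in Hc by lra.
    assert (Hd : dphi c <= 0).
    { unfold dphi. assert (A := re_le_Cmod (Cconj D * dF c)%C).
      rewrite Cmod_mult, Cmod_conj in A. assert (B := Hb c Hc).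
      assert (P := Cmod_ge_0 D). apply Rabs_le_between in A.
      assert (Cmod D * Cmod (dF c) <= Cmod D * dh c) by (apply Rmult_le_compat_l; lra). lra. }
    assert (Hle : phi y - phi x <= 0).
    { rewrite Ec. rewrite <- (Rmult_0_l (y - x)). apply Rmult_le_compat_r; lra. }
    assert (HD : Re (Cconj D * F y) - Re (Cconj D * F x) = Cmod D ^ 2).
    { rewrite Cmod2_alt. unfold D; simpl. unfold Re, Im; simpl. ring. }
    unfold phi in Hle.
    (* With [HD], [Hle] says [Cmod D ^ 2 <= Cmod D * (h y - h x)], to be divided by [Cmod D]. When
       [D] vanishes, [h y - h x] is nonnegative because [dh] dominates a modulus. *)
    destruct (Req_dec (Cmod D) 0) as [E0|E0].
    + rewrite E0.
      destruct (MVT_gen h x y dh) as [c' [Hc' Ec']].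
      * rewrite Rmin_left, Rmax_right by lra. intros; apply Hh; lra.
      * rewrite Rmin_left, Rmax_right by lra. intros t Ht.
        apply continuity_pt_filterlim. eapply is_derive_Rcontinuous, Hh; lra.
      * rewrite Rmin_left, Rmax_right in Hc' by lra. rewrite Ec'.
        apply Rmult_le_pos; [|lra]. apply Rle_trans with (2 := Hb c' Hc'). apply Cmod_ge_0.
    + assert (P := Cmod_ge_0 D). apply Rmult_le_reg_l with (Cmod D); [lra|]. nra.
Qed.

Lemma RC_lipschitz (lo hi : Rbar) (F dF : R -> C) (M x y : R) :
  is_primitive_on lo hi F dF ->
  (forall t, in_open_interval lo hi t -> Cmod (dF t) <= M) ->
  in_open_interval lo hi x -> in_open_interval lo hi y ->
  Cmod (F y - F x) <= M * Rabs (y - x).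
Proof.
  intros HF HM.
  assert (W : forall x y, x <= y -> in_open_interval lo hi x -> in_open_interval lo hi y ->
            Cmod (F y - F x) <= M * (y - x)).
  { intros x' y' Hxy Hx Hy.
    replace (M * (y' - x')) with (M * y' - M * x') by ring.
    apply (RC_mean_value F dF (fun t => M * t) (fun _ => M)); trivial.
    - intros t Ht; apply HF, (in_open_interval_between lo hi x' y'); trivial.
      rewrite Rmin_left, Rmax_right; lra.
    - intros; auto_derive; trivial; ring.
    - intros t Ht; apply HM, (in_open_interval_between lo hi x' y'); trivial.
      rewrite Rmin_left, Rmax_right; lra. }
  intros Hx Hy. destruct (Rle_dec x y).
  - rewrite Rabs_pos_eq by lra. now apply W.
  - rewrite <- Cmod_opp. replace (- (F y - F x))%C with (F x - F y)%C by ring.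
    rewrite Rabs_left by lra. replace (- (y - x)) with (x - y) by ring. apply W; trivial; lra.
Qed.

(** The difference of the two primitives has derivative 0, hence Lipschitz constant 0. *)
Lemma primitive_unique (lo hi : Rbar) (F G g : R -> C) (x y : R) :
  is_primitive_on lo hi F g -> is_primitive_on lo hi G g ->
  in_open_interval lo hi x -> in_open_interval lo hi y ->
  (F y - F x = G y - G x)%C.
Proof.
  intros HF HG Hx Hy.
  assert (H : Cmod ((F y - G y) - (F x - G x)) <= 0 * Rabs (y - x)).
  { apply (RC_lipschitz lo hi (fun t => F t - G t)%C (fun t => g t - g t)%C); trivial.
    - intros q Hq. apply is_RC_derive_minus; auto.
    - intros t Ht. replace (g t - g t)%C with (RtoC 0) by ring. rewrite Cmod_0; lra. }
  rewrite Rmult_0_l in H.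
  assert (E : (F y - G y - (F x - G x))%C = 0%C).
  { apply Cmod_eq_0. assert (A := Cmod_ge_0 (F y - G y - (F x - G x))). lra. }
  replace (F y - F x)%C with ((F y - G y - (F x - G x)) + (G y - G x))%C by ring.
  rewrite E; ring.
Qed.

Definition RC_prim (q0 : R) (g : R -> C) (q : R) : C :=
  (RInt (fun t => Re (g t)) q0 q, RInt (fun t => Im (g t)) q0 q).

Lemma RC_prim_point (q0 : R) (g : R -> C) : RC_prim q0 g q0 = 0%C.
Proof. unfold RC_prim. now rewrite !RInt_point. Qed.

Lemma RC_prim_correct (lo hi : Rbar) (q0 : R) (g : R -> C) :
  in_open_interval lo hi q0 ->
  (forall q, in_open_interval lo hi q -> RC_continuous g q) ->
  is_primitive_on lo hi (RC_prim q0 g) g.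
Proof.
  intros H0 Hg q Hq. apply is_RC_derive_iff.
  split; simpl.
  - apply (is_derive_RInt (V := R_NormedModule) (fun t => Re (g t))
      (fun t => RInt (fun t => Re (g t)) q0 t) q0 q); [|exact (proj1 (Hg q Hq))].
    generalize (in_open_interval_locally _ _ _ Hq). apply filter_imp. intros x Hx; simpl in x.
    apply (RInt_correct (V := R_CompleteNormedModule)). apply (ex_RInt_continuous (V := R_CompleteNormedModule)).
    intros t Ht. refine (proj1 (Hg t _)). now apply (in_open_interval_between lo hi q0 x).
  - apply (is_derive_RInt (V := R_NormedModule) (fun t => Im (g t))
      (fun t => RInt (fun t => Im (g t)) q0 t) q0 q); [|exact (proj2 (Hg q Hq))].
    generalize (in_open_interval_locally _ _ _ Hq). apply filter_imp. intros x Hx; simpl in x.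
    apply (RInt_correct (V := R_CompleteNormedModule)). apply (ex_RInt_continuous (V := R_CompleteNormedModule)).
    intros t Ht. refine (proj2 (Hg t _)). now apply (in_open_interval_between lo hi q0 x).
Qed.

(** * Complex series dominated by real series *)

Notation Csum_n := (sum_n (G := C_AbelianGroup)).

Lemma Re_Csum_n (u : nat -> C) (n : nat) : Re (Csum_n u n) = sum_n (fun k => Re (u k)) n.
Proof.
  induction n; [now rewrite !sum_O | rewrite !sum_Sn, <- IHn; reflexivity].
Qed.

Lemma Im_Csum_n (u : nat -> C) (n : nat) : Im (Csum_n u n) = sum_n (fun k => Im (u k)) n.
Proof.
  induction n; [now rewrite !sum_O | rewrite !sum_Sn, <- IHn; reflexivity].
Qed.

Lemma Csum_n_S (u : nat -> C) (n : nat) : Csum_n u (S n) = (Csum_n u n + u (S n))%C :> C.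
Proof. exact (sum_Sn (G := C_AbelianGroup) u n). Qed.

Lemma is_Cseries_iff (u : nat -> C) (l : C) :
  is_Cseries u l <->
  is_series (fun n => Re (u n)) (Re l) /\ is_series (fun n => Im (u n)) (Im l).
Proof.
  split.
  - intros H. split; intros P [eps He].
    + destruct (H (fun z => P (Re z))) as [N HN].
      { exists eps. intros y Hy. apply He, Hy. }
      exists N. intros n Hn. rewrite <- Re_Csum_n. now apply HN.
    + destruct (H (fun z => P (Im z))) as [N HN].
      { exists eps. intros y Hy. apply He, Hy. }
      exists N. intros n Hn. rewrite <- Im_Csum_n. now apply HN.
  - intros [H1 H2] P [eps He].
    destruct (H1 (ball (Re l) eps) (locally_ball _ _)) as [N1 HN1].
    destruct (H2 (ball (Im l) eps) (locally_ball _ _)) as [N2 HN2].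
    exists (max N1 N2). intros n Hn. apply He. split.
    + change (ball (Re l) eps (Re (Csum_n u n))). rewrite Re_Csum_n. apply HN1. lia.
    + change (ball (Im l) eps (Im (Csum_n u n))). rewrite Im_Csum_n. apply HN2. lia.
Qed.

Lemma is_Cseries_unique (u : nat -> C) (l m : C) : is_Cseries u l -> is_Cseries u m -> l = m.
Proof.
  intros H1 H2. apply is_Cseries_iff in H1 as [A1 B1]. apply is_Cseries_iff in H2 as [A2 B2].
  apply C_ext.
  - now rewrite <- (is_series_unique _ _ A1), <- (is_series_unique _ _ A2).
  - now rewrite <- (is_series_unique _ _ B1), <- (is_series_unique _ _ B2).
Qed.

Definition Cseries (u : nat -> C) : C :=
  (Series (fun n => Re (u n)), Series (fun n => Im (u n))).

Lemma Cseries_correct (u : nat -> C) (m : nat -> R) :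
  (forall n, Cmod (u n) <= m n) -> ex_series m -> is_Cseries u (Cseries u).
Proof.
  intros Hu Hm. apply is_Cseries_iff; split; simpl; apply Series_correct;
    apply (ex_series_le (K := R_AbsRing) (V := R_CompleteNormedModule) _ m); trivial; intros n.
  - apply Rle_trans with (2 := Hu n). apply re_le_Cmod.
  - apply Rle_trans with (2 := Hu n). apply im_le_Cmod.
Qed.

Lemma is_Cseries_ext (u v : nat -> C) (l : C) :
  (forall n, u n = v n) -> is_Cseries u l -> is_Cseries v l.
Proof. apply is_series_ext. Qed.

Lemma is_Cseries_plus (u v : nat -> C) (l m : C) :
  is_Cseries u l -> is_Cseries v m -> is_Cseries (fun n => u n + v n)%C (l + m)%C.
Proof. apply (is_series_plus (K := C_AbsRing) (V := C_NormedModule)). Qed.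

Lemma is_Cseries_cmult (c : C) (u : nat -> C) (l : C) :
  is_Cseries u l -> is_Cseries (fun n => c * u n)%C (c * l)%C.
Proof. apply (is_series_scal (K := C_AbsRing) (V := C_NormedModule)). Qed.

Lemma is_Cseries_minus (u v : nat -> C) (l m : C) :
  is_Cseries u l -> is_Cseries v m -> is_Cseries (fun n => u n - v n)%C (l - m)%C.
Proof. apply (is_series_minus (K := C_AbsRing) (V := C_NormedModule)). Qed.

Lemma is_Cseries_decr_1 (u : nat -> C) (l : C) :
  is_Cseries (fun n => u (S n)) l -> is_Cseries u (u O + l)%C.
Proof.
  intros H. apply (is_series_decr_1 (K := C_AbsRing) (V := C_NormedModule)).
  assert (E : l = (u O + l + - u O)%C) by ring.
  rewrite E in H. exact H.
Qed.

Lemma is_Cseries_incr_1 (u : nat -> C) (l : C) :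
  is_Cseries u l -> is_Cseries (fun n => u (S n)) (l - u O)%C.
Proof.
  intros H. apply (is_series_incr_1 (K := C_AbsRing) (V := C_NormedModule)).
  assert (E : l = (l - u O + u O)%C) by ring.
  rewrite E in H. exact H.
Qed.

Lemma Cmod_Csum_n (u : nat -> C) (m : nat -> R) (n : nat) :
  (forall k, Cmod (u k) <= m k) -> Cmod (Csum_n u n) <= sum_n m n.
Proof.
  intros H. induction n.
  - rewrite !sum_O; auto.
  - rewrite Csum_n_S, sum_Sn. apply Rle_trans with (1 := Cmod_triangle _ _).
    apply Rplus_le_compat; auto.
Qed.

Lemma is_Cseries_eps (u : nat -> C) (l : C) :
  (forall eps, 0 < eps -> exists N, forall n, (N <= n)%nat -> Cmod (Csum_n u n - l) < eps) ->
  is_Cseries u l.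
Proof.
  intros H P [eps He]. destruct (H eps (cond_pos eps)) as [N HN].
  exists N; intros n Hn. apply He. apply C_NormedModule_mixin_compat1. now apply HN.
Qed.

Lemma is_Cseries_0 : is_Cseries (fun _ => RtoC 0) (RtoC 0).
Proof.
  apply is_Cseries_eps. intros eps He. exists O. intros n _.
  assert (E : Csum_n (fun _ => RtoC 0) n = RtoC 0 :> C).
  { induction n; [apply sum_O | rewrite Csum_n_S, IHn; ring]. }
  rewrite E. replace (RtoC 0 - RtoC 0)%C with (RtoC 0) by ring. now rewrite Cmod_0.
Qed.

(** Balls of [C] are boxes, so membership bounds the modulus only up to a factor [sqrt 2]; this
    cruder factor accounts for the halved radii below. *)
Lemma sqrt2_le_2 : sqrt 2 <= 2.
Proof. rewrite <- (sqrt_square 2) at 2 by lra. apply sqrt_le_1_alt; lra. Qed.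

Lemma is_Cseries_eps_inv (u : nat -> C) (l : C) (eps : R) :
  is_Cseries u l -> 0 < eps ->
  exists N, forall n, (N <= n)%nat -> Cmod (Csum_n u n - l) < eps.
Proof.
  intros H He.
  assert (He2 : 0 < eps / 2) by lra.
  destruct (H _ (locally_ball l (mkposreal _ He2))) as [N HN].
  exists N; intros n Hn. specialize (HN n Hn).
  apply C_NormedModule_mixin_compat2 in HN. simpl in HN.
  apply Rlt_le_trans with (1 := HN).
  assert (Hsqrt := sqrt2_le_2).
  nra.
Qed.

Lemma is_series_eps_inv (u : nat -> R) (l : R) (eps : R) :
  is_series u l -> 0 < eps ->
  exists N, forall n, (N <= n)%nat -> Rabs (sum_n u n - l) < eps.
Proof.
  intros H He. destruct (H _ (locally_ball l (mkposreal _ He))) as [N HN].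
  exists N; intros n Hn. apply (HN n Hn).
Qed.

Lemma Cmod_is_Cseries (u : nat -> C) (m : nat -> R) (l : C) (M : R) :
  (forall k, Cmod (u k) <= m k) -> is_Cseries u l -> is_series m M -> Cmod l <= M.
Proof.
  intros Hu Hl HM. apply le_epsilon. intros eps He.
  destruct (is_Cseries_eps_inv u l (eps / 2) Hl) as [N1 H1]; [lra|].
  destruct (is_series_eps_inv m M (eps / 2) HM) as [N2 H2]; [lra|].
  specialize (H1 (max N1 N2)); specialize (H2 (max N1 N2)).
  assert (A := H1 ltac:(lia)). assert (B := H2 ltac:(lia)).
  assert (D := Cmod_Csum_n u m (max N1 N2) Hu).
  set (s := Csum_n u (max N1 N2)) in *.
  assert (E : Cmod l <= Cmod s + Cmod (s - l)).
  { rewrite <- (Cmod_opp (s - l)). replace l with (s + - (s - l))%C at 1 by ring.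
    apply Cmod_triangle. }
  apply Rabs_lt_between in B. lra.
Qed.

Lemma is_series_tail (m : nat -> R) (M : R) (N : nat) :
  is_series m M -> is_series (fun k => m (S N + k)%nat) (M - sum_n m N).
Proof.
  intros H. apply (is_series_incr_n m (S N)); [lia|].
  assert (E : M = M - sum_n m N + sum_n m N) by ring.
  rewrite E in H. exact H.
Qed.

Lemma is_Cseries_tail (u : nat -> C) (l : C) (N : nat) :
  is_Cseries u l -> is_Cseries (fun k => u (S N + k)%nat) (l - Csum_n u N)%C.
Proof.
  intros H. apply (is_series_incr_n (K := C_AbsRing) (V := C_NormedModule) u (S N)); [lia|].
  assert (E : l = (l - Csum_n u N + Csum_n u N)%C) by ring.
  rewrite E in H. exact H.
Qed.

(** The bound depends on the majorant alone, so it is uniform in any parameter of [u]. Continuity of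
    sums and termwise integration both rest on it. *)
Lemma Cmod_tail_le (u : nat -> C) (m : nat -> R) (l : C) (M : R) (N : nat) :
  (forall k, Cmod (u k) <= m k) -> is_Cseries u l -> is_series m M ->
  Cmod (l - Csum_n u N) <= M - sum_n m N.
Proof.
  intros Hu Hl HM.
  apply (Cmod_is_Cseries (fun k => u (S N + k)%nat) (fun k => m (S N + k)%nat)); auto.
  - now apply is_Cseries_tail.
  - now apply is_series_tail.
Qed.

Lemma is_Cseries_Csum_n (a : nat -> nat -> C) (l : nat -> C) (K : nat) :
  (forall k, is_Cseries (fun n => a n k) (l k)) ->
  is_Cseries (fun n => Csum_n (a n) K) (Csum_n l K).
Proof.
  intros H. induction K.
  - rewrite sum_O. apply is_Cseries_ext with (2 := H O). intros n. now rewrite sum_O.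
  - rewrite Csum_n_S. apply is_Cseries_ext with (fun n => Csum_n (a n) K + a n (S K))%C.
    + intros n. now rewrite Csum_n_S.
    + now apply is_Cseries_plus.
Qed.

(** With a product majorant, cutting every row after column [K] costs at most [A n] times the tail
    of [B], and summing over [n] costs [SA] times that tail. *)
Lemma double_Cseries_swap (a : nat -> nat -> C) (A B : nat -> R) (row col : nat -> C) (S : C) :
  ex_series A -> ex_series B ->
  (forall n k, Cmod (a n k) <= A n * B k) ->
  (forall n, is_Cseries (a n) (row n)) ->
  (forall k, is_Cseries (fun n => a n k) (col k)) ->
  is_Cseries row S -> is_Cseries col S.
Proof.
  intros [SA HA] [SB HB] Hb Hrow Hcol HS.
  apply is_Cseries_eps. intros eps He.
  (* The added 1 keeps the divisor positive if [SA] is 0. *)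
  assert (P : 0 < Rabs SA + 1) by (assert (Q := Rabs_pos SA); lra).
  destruct (is_series_eps_inv B SB (eps / (Rabs SA + 1)) HB) as [N HN].
  { now apply Rdiv_lt_0_compat. }
  exists N. intros K HK. specialize (HN K HK).
  rewrite <- Cmod_opp. replace (- (Csum_n col K - S))%C with (S - Csum_n col K)%C by ring.
  apply Rle_lt_trans with (SA * (SB - sum_n B K)).
  - apply (Cmod_is_Cseries (fun n => row n - Csum_n (a n) K)%C (fun n => A n * (SB - sum_n B K))).
    + intros n. replace (A n * (SB - sum_n B K)) with (A n * SB - sum_n (fun k => A n * B k) K).
      * apply (Cmod_tail_le (a n) (fun k => A n * B k)); auto.
        apply (is_series_scal (K := R_AbsRing) (V := R_NormedModule)), HB.
      * replace (sum_n (fun k => A n * B k) K) with (A n * sum_n B K); [ring|].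
        symmetry. exact (sum_n_mult_l (K := R_Ring) (A n) B K).
    + apply is_Cseries_minus; trivial. now apply is_Cseries_Csum_n.
    + apply is_series_ext with (fun n => scal (SB - sum_n B K) (A n)).
      { intros; unfold scal; simpl; unfold mult; simpl; ring. }
      replace (SA * (SB - sum_n B K)) with (scal (SB - sum_n B K) SA).
      { apply (is_series_scal (K := R_AbsRing) (V := R_NormedModule)), HA. }
      unfold scal; simpl; unfold mult; simpl; ring.
  - rewrite Rabs_minus_sym in HN. apply Rle_lt_trans with (Rabs SA * Rabs (SB - sum_n B K)).
    { rewrite <- Rabs_mult. apply Rle_abs. }
    apply Rle_lt_trans with (Rabs SA * (eps / (Rabs SA + 1))).
    { apply Rmult_le_compat_l; [apply Rabs_pos|lra]. }
    apply Rmult_lt_reg_r with (Rabs SA + 1); trivial. field_simplify; [|lra].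
    assert (Q := Rabs_pos SA). nra.
Qed.

Lemma RC_continuous_eps (g : R -> C) (q : R) :
  (forall eps, 0 < eps -> locally q (fun t => Cmod (g t - g q) < eps)) -> RC_continuous g q.
Proof.
  intros H. split; apply filterlim_locally; intros eps;
    generalize (H eps (cond_pos eps)); apply filter_imp; intros t Ht.
  - apply Rle_lt_trans with (2 := Ht). apply (re_le_Cmod (g t - g q)%C).
  - apply Rle_lt_trans with (2 := Ht). apply (im_le_Cmod (g t - g q)%C).
Qed.

Lemma RC_continuous_eps_inv (g : R -> C) (q eps : R) :
  RC_continuous g q -> 0 < eps -> locally q (fun t => Cmod (g t - g q) < eps).
Proof.
  intros [H1 H2] He. assert (He2 : 0 < eps / 2) by lra.
  generalize (filter_and _ _ (proj1 (filterlim_locally _ _) H1 (mkposreal _ He2))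
             (proj1 (filterlim_locally _ _) H2 (mkposreal _ He2))).
  apply filter_imp. intros t [A B].
  assert (A' := C_NormedModule_mixin_compat2 (g q) (g t) (mkposreal _ He2) (conj A B)).
  apply Rlt_le_trans with (1 := A'). simpl.
  assert (Hsqrt := sqrt2_le_2).
  nra.
Qed.

Lemma RC_continuous_Csum_n (u : nat -> R -> C) (q : R) (N : nat) :
  (forall n, RC_continuous (u n) q) -> RC_continuous (fun t => Csum_n (fun n => u n t) N) q.
Proof.
  intros H. induction N.
  - destruct (H O) as [A B].
    split; [eapply continuous_ext, A | eapply continuous_ext, B]; intros t; now rewrite sum_O.
  - destruct (RC_continuous_plus _ _ _ IHN (H (S N))) as [A B].
    split; [eapply continuous_ext, A | eapply continuous_ext, B]; intros t; now rewrite Csum_n_S.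
Qed.

Lemma RC_continuous_dominated_series (lo hi : Rbar) (u : nat -> R -> C) (U : R -> C) (m : nat -> R) :
  ex_series m ->
  (forall n q, in_open_interval lo hi q -> Cmod (u n q) <= m n) ->
  (forall n q, in_open_interval lo hi q -> RC_continuous (u n) q) ->
  (forall q, in_open_interval lo hi q -> is_Cseries (fun n => u n q) (U q)) ->
  forall q, in_open_interval lo hi q -> RC_continuous U q.
Proof.
  intros [M HM] Hm Hc HU q Hq. apply RC_continuous_eps. intros eps He.
  destruct (is_series_eps_inv m M (eps / 3) HM) as [N HN]; [lra|].
  specialize (HN N (le_n N)). rewrite Rabs_minus_sym in HN.
  assert (T : forall t, in_open_interval lo hi t -> Cmod (U t - Csum_n (fun n => u n t) N) < eps / 3).
  { intros t Ht. apply Rle_lt_trans with (2 := HN). apply Rle_trans with (2 := Rle_abs _).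
    apply Cmod_tail_le; auto. }
  assert (W := RC_continuous_eps_inv _ q (eps / 3) (RC_continuous_Csum_n u q N (fun n => Hc n q Hq)) ltac:(lra)).
  generalize (filter_and _ _ W (in_open_interval_locally _ _ _ Hq)). apply filter_imp.
  intros t [A Ht]. assert (B := T t Ht). assert (D := T q Hq).
  set (St := Csum_n (fun n => u n t) N) in *. set (Sq := Csum_n (fun n => u n q) N) in *.
  replace (U t - U q)%C with ((U t - St) + ((St - Sq) + - (U q - Sq)))%C by ring.
  apply Rle_lt_trans with (1 := Cmod_triangle _ _).
  assert (E := Cmod_triangle (St - Sq) (- (U q - Sq))). rewrite Cmod_opp in E. lra.
Qed.

Lemma RC_derive_Csum_n (u du : nat -> R -> C) (q : R) (N : nat) :
  (forall n, is_RC_derive (u n) q (du n q)) ->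
  is_RC_derive (fun t => Csum_n (fun n => u n t) N) q (Csum_n (fun n => du n q) N).
Proof.
  intros H. now apply (is_derive_sum_n (K := R_AbsRing) (V := C_R_NormedModule) u N q (fun n => du n q)).
Qed.

(** The primitive of the sum minus a partial sum of primitives has a uniformly small tail of the
    series as derivative; the Lipschitz estimate from [q0], where the difference vanishes, carries
    the smallness over. *)
Lemma RC_prim_series (lo hi : R) (q0 : R) (u : nat -> R -> C) (U : R -> C) (m : nat -> R) :
  lo < q0 < hi ->
  ex_series m ->
  (forall n q, lo < q < hi -> Cmod (u n q) <= m n) ->
  (forall n q, lo < q < hi -> RC_continuous (u n) q) ->
  (forall q, lo < q < hi -> is_Cseries (fun n => u n q) (U q)) ->
  forall q, lo < q < hi ->
  is_Cseries (fun n => RC_prim q0 (u n) q) (RC_prim q0 U q).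
Proof.
  intros H0 [M HM] Hm Hc HU q Hq.
  assert (HcU := RC_continuous_dominated_series lo hi u U m (ex_intro _ M HM) Hm Hc HU).
  apply is_Cseries_eps. intros eps He.
  assert (P : 0 < Rabs (q - q0) + 1) by (assert (Q := Rabs_pos (q - q0)); lra).
  destruct (is_series_eps_inv m M (eps / (Rabs (q - q0) + 1)) HM) as [N HN].
  { now apply Rdiv_lt_0_compat. }
  exists N. intros n Hn. specialize (HN n Hn). rewrite Rabs_minus_sym in HN.
  rewrite <- Cmod_opp.
  pose (F := fun t => (RC_prim q0 U t - Csum_n (fun n => RC_prim q0 (u n) t) n)%C).
  assert (L : Cmod (F q - F q0) <= (M - sum_n m n) * Rabs (q - q0)).
  { apply (RC_lipschitz lo hi F (fun t => U t - Csum_n (fun n => u n t) n)%C); trivial.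
    - intros t Ht. apply is_RC_derive_minus.
      + now apply (RC_prim_correct lo hi).
      + apply RC_derive_Csum_n. intros k.
        apply (RC_prim_correct lo hi); [exact H0 | intros; now apply Hc | trivial].
    - intros t Ht. apply Cmod_tail_le; auto. }
  assert (F0 : F q0 = 0%C).
  { unfold F. rewrite RC_prim_point.
    assert (Z : Csum_n (fun n => RC_prim q0 (u n) q0) n = RtoC 0 :> C).
    { clear. induction n; [rewrite sum_O | rewrite Csum_n_S, IHn]; rewrite RC_prim_point; trivial. ring. }
    rewrite Z. ring. }
  rewrite F0 in L. replace (- (Csum_n (fun n0 => RC_prim q0 (u n0) q) n - RC_prim q0 U q))%C
    with (F q - 0)%C by (unfold F; ring).
  apply Rle_lt_trans with (1 := L).
  apply Rle_lt_trans with (eps / (Rabs (q - q0) + 1) * Rabs (q - q0)).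
  { apply Rmult_le_compat_r; [apply Rabs_pos|]. apply Rle_trans with (1 := Rle_abs _). lra. }
  apply Rmult_lt_reg_r with (Rabs (q - q0) + 1); trivial. field_simplify; [|lra].
  assert (Q := Rabs_pos (q - q0)). nra.
Qed.

(** * The complex exponential and powers of real numbers *)

Lemma Cexp_plus (u v : C) : Cexp (u + v) = (Cexp u * Cexp v)%C.
Proof.
  apply C_ext; unfold Cexp, Re, Im; simpl; rewrite exp_plus; [rewrite cos_plus | rewrite sin_plus]; ring.
Qed.

Lemma Cexp_0 : Cexp 0 = 1%C.
Proof. apply C_ext; unfold Cexp, Re, Im; simpl; rewrite exp_0; [rewrite cos_0 | rewrite sin_0]; ring. Qed.

Lemma Cexp_opp (w : C) : Cexp (- w) = (1 / Cexp w)%C.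
Proof.
  assert (H : (Cexp (- w) * Cexp w)%C = 1%C).
  { rewrite <- Cexp_plus, <- Cexp_0. f_equal; ring. }
  assert (N : Cexp w <> 0%C).
  { intros E. rewrite E, Cmult_0_r in H. apply RtoC_inj in H; lra. }
  rewrite <- H. field; trivial.
Qed.

Lemma Cmod_Cexp (w : C) : Cmod (Cexp w) = exp (Re w).
Proof.
  unfold Cmod, Cexp; simpl.
  replace (_ + _) with ((exp (Re w)) ^ 2 * ((sin (Im w))² + (cos (Im w))²))
    by (unfold Rsqr, Re, Im; simpl; ring).
  rewrite sin2_cos2, Rmult_1_r, sqrt_pow2; trivial. left; apply exp_pos.
Qed.

Lemma is_RC_derive_Cexp (F : R -> C) (q : R) (l : C) :
  is_RC_derive F q l -> is_RC_derive (fun t => Cexp (F t)) q (l * Cexp (F q))%C.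
Proof.
  intros H. apply is_RC_derive_iff in H as [H1 H2].
  assert (A : is_derive (fun t => exp (Re (F t))) q (Re l * exp (Re (F q)))).
  { refine (is_derive_comp exp (fun t => Re (F t)) q _ _ _ H1). apply is_derive_exp. }
  apply is_RC_derive_iff; split.
  - replace (Re (l * Cexp (F q))%C) with
      (Re l * exp (Re (F q)) * cos (Im (F q)) + exp (Re (F q)) * (Im l * - sin (Im (F q))))
      by (unfold Cexp, Re, Im; simpl; ring).
    refine (is_derive_Rmult (fun t => exp (Re (F t))) (fun t => cos (Im (F t))) q _ _ A _).
    refine (is_derive_comp cos (fun t => Im (F t)) q _ _ _ H2). apply is_derive_cos.
  - replace (Im (l * Cexp (F q))%C) with
      (Re l * exp (Re (F q)) * sin (Im (F q)) + exp (Re (F q)) * (Im l * cos (Im (F q))))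
      by (unfold Cexp, Re, Im; simpl; ring).
    refine (is_derive_Rmult (fun t => exp (Re (F t))) (fun t => sin (Im (F t))) q _ _ A _).
    refine (is_derive_comp sin (fun t => Im (F t)) q _ _ _ H2). apply is_derive_sin.
Qed.

Lemma is_RC_derive_RtoC (g : R -> R) (q l : R) :
  is_derive g q l -> is_RC_derive (fun t => RtoC (g t)) q (RtoC l).
Proof.
  intros H. apply is_RC_derive_iff; split; simpl; trivial.
  apply (is_derive_const (K := R_AbsRing) (V := R_NormedModule)).
Qed.

(** Taylor polynomial of the exponential of [w t] in the real variable [t], introduced so that the
    mean value inequality applies on [[0, 1]]; the series at [w] is the case [t = 1]. *)
Definition Cexp_partial (w : C) (n : nat) (t : R) : C :=
  Csum_n (fun k => RtoC (t ^ k / INR (fact k)) * w ^ k)%C n.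

Lemma is_derive_pow_fact (k : nat) (t : R) :
  is_derive (fun t => t ^ S k / INR (fact (S k))) t (t ^ k / INR (fact k)).
Proof.
  assert (A := INR_fact_neq_0 k). assert (B := not_0_INR (S k) ltac:(lia)).
  rewrite fact_simpl, mult_INR. auto_derive; trivial.
  replace (match k with O => 1 | S _ => INR k + 1 end) with (INR (S k)) by reflexivity.
  simpl pred. field. split; trivial.
Qed.

Lemma Cexp_partial_derive (w : C) (n : nat) (t : R) :
  is_RC_derive (Cexp_partial w (S n)) t (w * Cexp_partial w n t)%C.
Proof.
  induction n.
  - apply (is_RC_derive_ext (fun t => 1 + RtoC t * w)%C).
    + intros x; simpl in x. unfold Cexp_partial. rewrite Csum_n_S, sum_O. simpl.
      replace (1 / 1) with 1 by field. replace (x * 1 / 1) with x by field. ring.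
    + unfold Cexp_partial. rewrite sum_O. simpl. replace (1 / 1) with 1 by field.
      eapply is_RC_derive_eq.
      * apply is_RC_derive_plus. apply is_RC_derive_const.
        apply is_RC_derive_mult. apply is_RC_derive_RtoC. apply (is_derive_id (K := R_AbsRing)).
        apply is_RC_derive_const.
      * unfold one; simpl. ring.
  - apply (is_RC_derive_ext
      (fun t => Cexp_partial w (S n) t + RtoC (t ^ S (S n) / INR (fact (S (S n)))) * w ^ (S (S n)))%C).
    + intros x. unfold Cexp_partial. now rewrite (Csum_n_S _ (S n)).
    + eapply is_RC_derive_eq.
      * apply is_RC_derive_plus. apply IHn.
        apply is_RC_derive_mult. apply is_RC_derive_RtoC, is_derive_pow_fact.
        apply is_RC_derive_const.
      * unfold Cexp_partial. rewrite Csum_n_S. simpl. ring.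
Qed.

Lemma exp_le_compat (x y : R) : x <= y -> exp x <= exp y.
Proof. intros [H|<-]; [left; now apply exp_increasing | right; trivial]. Qed.

(** The derivative in [t] of each remainder is [w] times the preceding remainder, so the mean value
    inequality from 0 gives an induction on [n]. The factor [exp (Cmod w)] bounds the exponential
    itself on [[0, 1]]. *)
Lemma Cexp_remainder (w : C) (n : nat) (t : R) :
  0 <= t <= 1 ->
  Cmod (Cexp (w * RtoC t) - Cexp_partial w n t)
    <= exp (Cmod w) * Cmod w ^ S n * (t ^ S n / INR (fact (S n))).
Proof.
  assert (D : forall s, is_RC_derive (fun t => Cexp (w * RtoC t)%C) s (w * Cexp (w * RtoC s))%C).
  { intros s. eapply is_RC_derive_eq.
    - apply is_RC_derive_Cexp, is_RC_derive_cmult, is_RC_derive_RtoC, (is_derive_id (K := R_AbsRing)).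
    - unfold one; simpl. ring. }
  assert (P0 : forall m, (Cexp (w * RtoC 0) - Cexp_partial w m 0)%C = RtoC 0).
  { intros m. rewrite Cmult_0_r, Cexp_0.
    assert (E : Cexp_partial w m 0 = RtoC 1).
    { unfold Cexp_partial. induction m.
      - rewrite sum_O; simpl. replace (1 / 1) with 1 by field. ring.
      - rewrite Csum_n_S, IHm. rewrite pow_ne_zero by lia.
        unfold Rdiv. rewrite Rmult_0_l. ring. }
    rewrite E; ring. }
  revert t. induction n; intros t Ht.
  - assert (H := RC_mean_value (fun t => Cexp (w * RtoC t) - Cexp_partial w O t)%C
      (fun t => w * Cexp (w * RtoC t))%C (fun t => exp (Cmod w) * Cmod w * t)
      (fun _ => exp (Cmod w) * Cmod w) 0 t).
    cbv beta in H. rewrite P0 in H.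
    replace (Cexp (w * t) - Cexp_partial w 0 t - 0)%C
      with (Cexp (w * t) - Cexp_partial w 0 t)%C in H by ring.
    simpl. replace (exp (Cmod w) * (Cmod w * 1) * (t * 1 / 1))
      with (exp (Cmod w) * Cmod w * t - exp (Cmod w) * Cmod w * 0) by field.
    apply H; [lra | | |].
    + intros s Hs. eapply is_RC_derive_eq.
      * apply is_RC_derive_minus. apply D.
        apply (is_RC_derive_ext (fun _ => RtoC 1)).
        { intros x. unfold Cexp_partial. rewrite sum_O. simpl.
          replace (1 / 1) with 1 by field. ring. }
        apply is_RC_derive_const.
      * ring.
    + intros; auto_derive; trivial; ring.
    + intros s Hs. rewrite Cmod_mult, Rmult_comm. apply Rmult_le_compat_r; [apply Cmod_ge_0|].
      rewrite Cmod_Cexp. apply exp_le_compat.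
      apply Rle_trans with (1 := Rle_abs _). apply Rle_trans with (1 := re_le_Cmod _).
      rewrite Cmod_mult, Cmod_R, Rabs_pos_eq by lra.
      assert (A := Cmod_ge_0 w). nra.
  - assert (H := RC_mean_value (fun t => Cexp (w * RtoC t) - Cexp_partial w (S n) t)%C
      (fun t => w * (Cexp (w * RtoC t) - Cexp_partial w n t))%C
      (fun t => exp (Cmod w) * Cmod w ^ S (S n) * (t ^ S (S n) / INR (fact (S (S n)))))
      (fun t => exp (Cmod w) * Cmod w ^ S (S n) * (t ^ S n / INR (fact (S n)))) 0 t).
    cbv beta in H. rewrite P0 in H.
    replace (Cexp (w * t) - Cexp_partial w (S n) t - 0)%C
      with (Cexp (w * t) - Cexp_partial w (S n) t)%C in H by ring.
    rewrite (pow_ne_zero (S (S n))) in H by lia.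
    replace (0 / INR (fact (S (S n)))) with 0 in H by (unfold Rdiv; ring).
    rewrite Rmult_0_r, Rminus_0_r in H.
    apply H; [lra | | |].
    + intros s Hs. eapply is_RC_derive_eq.
      * apply is_RC_derive_minus. apply D. apply Cexp_partial_derive.
      * ring.
    + intros s Hs. apply is_derive_scal, is_derive_pow_fact.
    + intros s Hs. rewrite Cmod_mult.
      replace (exp (Cmod w) * Cmod w ^ S (S n) * (s ^ S n / INR (fact (S n)))) with
        (Cmod w * (exp (Cmod w) * Cmod w ^ S n * (s ^ S n / INR (fact (S n))))) by (simpl; unfold Rdiv; ring).
      apply Rmult_le_compat_l; [apply Cmod_ge_0|]. apply IHn; lra.
Qed.

Lemma is_series_exp (x : R) : is_series (fun k => x ^ k / INR (fact k)) (exp x).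
Proof.
  apply is_series_ext with (2 := is_exp_Reals x).
  intros n. unfold scal; simpl; unfold mult; simpl. now rewrite pow_n_pow.
Qed.

(** At [t = 1] the remainder is at most a fixed multiple of the general term of the real series for
    [exp (Cmod w)], which tends to 0. *)
Lemma is_Cseries_Cexp (w : C) : is_Cseries (fun k => w ^ k * RtoC (/ INR (fact k)))%C (Cexp w).
Proof.
  apply is_Cseries_eps. intros eps He.
  assert (Hlim := ex_series_lim_0 _ (ex_intro _ _ (is_series_exp (Cmod w)))).
  assert (P := exp_pos (Cmod w)).
  destruct (proj1 (filterlim_locally _ _) Hlim (mkposreal _ (Rdiv_lt_0_compat _ _ He P))) as [N HN].
  exists N. intros n Hn. specialize (HN (S n) ltac:(lia)).
  change (Rabs (Cmod w ^ S n / INR (fact (S n)) - 0) < eps / exp (Cmod w)) in HN.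
  rewrite Rminus_0_r in HN.
  assert (H := Cexp_remainder w n 1 ltac:(lra)).
  rewrite <- Cmod_opp.
  replace (- (Csum_n (fun k => w ^ k * RtoC (/ INR (fact k)))%C n - Cexp w))%C
    with (Cexp (w * RtoC 1) - Cexp_partial w n 1)%C.
  - apply Rle_lt_trans with (1 := H). rewrite pow1.
    replace (exp (Cmod w) * Cmod w ^ S n * (1 / INR (fact (S n))))
      with (exp (Cmod w) * (Cmod w ^ S n / INR (fact (S n)))) by (unfold Rdiv; ring).
    apply Rle_lt_trans with (exp (Cmod w) * Rabs (Cmod w ^ S n / INR (fact (S n)))).
    { apply Rmult_le_compat_l; [lra | apply Rle_abs]. }
    apply Rmult_lt_reg_l with (/ exp (Cmod w)); [now apply Rinv_0_lt_compat|].
    rewrite <- Rmult_assoc, Rinv_l, Rmult_1_l by lra.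
    unfold Rdiv in HN. lra.
  - rewrite Cmult_1_r.
    replace (Cexp_partial w n 1) with (Csum_n (fun k => w ^ k * RtoC (/ INR (fact k)))%C n); [ring|].
    apply sum_n_ext. intros k. rewrite pow1. unfold Rdiv. rewrite Rmult_1_l. apply Cmult_comm.
Qed.

(** Written as a reciprocal so that it unfolds to the summand of [is_hurwitz_zeta]. *)
Definition negpow (s : C) (x : R) : C := (1 / Cpower (RtoC x) s)%C.

Lemma negpow_exp (s : C) (x : R) : negpow s x = Cexp (- (s * Clog (RtoC x))).
Proof. unfold negpow, Cpower. now rewrite Cexp_opp. Qed.

Lemma Clog_pos (x : R) : 0 < x -> Clog (RtoC x) = RtoC (ln x).
Proof.
  intros H. unfold Clog, Carg. rewrite Cmod_R, Rabs_pos_eq by lra. simpl.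
  destruct (Rle_dec 0 0) as [_|]; [|lra].
  replace (x / x) with 1 by (field; lra). now rewrite acos_1.
Qed.

Lemma Clog_neg (x : R) : x < 0 -> Clog (RtoC x) = (ln (- x), PI).
Proof.
  intros H. unfold Clog, Carg. rewrite Cmod_R, Rabs_left by lra. simpl.
  destruct (Rle_dec 0 0) as [_|]; [|lra].
  replace (x / - x) with (- (1)) by (field; lra).
  now rewrite acos_opp, acos_1, Rminus_0_r.
Qed.

Lemma Cexp_Clog (x : R) : x <> 0 -> Cexp (Clog (RtoC x)) = RtoC x.
Proof.
  intros H. destruct (Rle_lt_dec x 0).
  - rewrite Clog_neg by lra. apply C_ext; unfold Cexp, Re, Im; simpl.
    + rewrite exp_ln, cos_PI by lra; ring.
    + rewrite sin_PI; ring.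
  - rewrite Clog_pos by lra. apply C_ext; unfold Cexp, Re, Im; simpl.
    + rewrite exp_ln, cos_0 by lra; ring.
    + rewrite sin_0; ring.
Qed.

(** On each side of 0 the argument is constant, 0 or [PI], so the branch cut is invisible along the
    real line. This is what admits terms with a negative base. *)
Lemma Clog_derive (x : R) : x <> 0 -> is_RC_derive (fun t => Clog (RtoC t)) x (RtoC (/ x)).
Proof.
  intros H. destruct (Rle_lt_dec x 0).
  - apply (is_RC_derive_ext_loc (fun t => (ln (- t), PI))).
    + apply filter_imp with (2 := open_lt 0 x ltac:(lra)). intros t Ht. now rewrite Clog_neg.
    + apply is_RC_derive_iff; split; simpl.
      * auto_derive; [lra | field; lra].
      * apply (is_derive_const (K := R_AbsRing) (V := R_NormedModule)).
  - apply (is_RC_derive_ext_loc (fun t => RtoC (ln t))).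
    + apply filter_imp with (2 := open_gt 0 x ltac:(lra)). intros t Ht. now rewrite Clog_pos.
    + apply is_RC_derive_RtoC. auto_derive; [lra | field; lra].
Qed.

Lemma negpow_plus (s w : C) (x : R) : negpow (s + w) x = (negpow s x * Cexp (- (w * Clog (RtoC x))))%C.
Proof. rewrite !negpow_exp, <- Cexp_plus. f_equal; ring. Qed.

Lemma negpow_0 (x : R) : negpow 0 x = 1%C.
Proof. rewrite negpow_exp, <- Cexp_0. f_equal; ring. Qed.

Lemma negpow_derive (s : C) (x : R) :
  x <> 0 -> is_RC_derive (negpow s) x (- s * negpow (s + 1) x)%C.
Proof.
  intros H.
  apply (is_RC_derive_ext (fun t => Cexp (- s * Clog (RtoC t))%C)).
  { intros t. rewrite negpow_exp. f_equal; ring. }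
  eapply is_RC_derive_eq.
  - apply is_RC_derive_Cexp, is_RC_derive_cmult, Clog_derive, H.
  - rewrite negpow_plus, negpow_exp.
    replace (- (s * Clog x))%C with (- s * Clog x)%C by ring.
    rewrite Cmult_1_l, Cexp_opp, Cexp_Clog by trivial. rewrite RtoC_inv by trivial.
    unfold Cdiv. ring.
Qed.

Lemma Cmod_negpow (s : C) (x : R) : 0 < x -> Cmod (negpow s x) = Rpower x (- Re s).
Proof.
  intros H. rewrite negpow_exp, Clog_pos, Cmod_Cexp by trivial.
  unfold Rpower. f_equal. unfold Re; simpl. ring.
Qed.

(** The coefficient of [w ^ k] in the expansion of [x^(-(s0 + w))]. *)
Definition negpow_coef (s0 : C) (k : nat) (x : R) : C :=
  (negpow s0 x * ((- Clog (RtoC x)) ^ k * RtoC (/ INR (fact k))))%C.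

Lemma Cpow_mult_l (u v : C) (k : nat) : ((u * v) ^ k = u ^ k * v ^ k)%C.
Proof. induction k; simpl; [|rewrite IHk]; ring. Qed.

Lemma negpow_series (s0 w : C) (x : R) :
  is_Cseries (fun k => negpow_coef s0 k x * w ^ k)%C (negpow (s0 + w) x).
Proof.
  rewrite negpow_plus.
  apply is_Cseries_ext with
    (fun k => negpow s0 x * ((- (w * Clog (RtoC x))) ^ k * RtoC (/ INR (fact k))))%C.
  - intros k. unfold negpow_coef.
    replace (- (w * Clog (RtoC x)))%C with (w * - Clog (RtoC x))%C by ring.
    rewrite Cpow_mult_l. ring.
  - apply is_Cseries_cmult, is_Cseries_Cexp.
Qed.

Lemma is_series_term_le (u : nat -> R) (l : R) (k : nat) :
  (forall j, 0 <= u j) -> is_series u l -> u k <= l.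
Proof.
  intros Hu Hl.
  assert (P : forall n, 0 <= sum_n u n).
  { induction n; [rewrite sum_O; auto|]. rewrite sum_Sn. apply Rplus_le_le_0_compat; auto. }
  apply Rle_trans with (sum_n u k).
  - destruct k; [rewrite sum_O; lra|]. rewrite sum_Sn. unfold plus; simpl. specialize (P k). lra.
  - apply (is_lim_seq_incr_compare (sum_n u) l); [exact Hl|].
    intros n. rewrite sum_Sn. unfold plus; simpl. specialize (Hu (S n)). lra.
Qed.

(** A single term of the series for [exp (rho * Cmod u)] is at most its sum. This yields Cauchy-type
    coefficient bounds for any radius [rho]. *)
Lemma Cmod_pow_fact_le (u : C) (rho : R) (k : nat) :
  0 < rho -> Cmod (u ^ k * RtoC (/ INR (fact k))) <= exp (rho * Cmod u) * (/ rho) ^ k.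
Proof.
  intros Hr. rewrite Cmod_mult, Cmod_pow, Cmod_R, Rabs_pos_eq.
  2: left; apply Rinv_0_lt_compat, INR_fact_lt_0.
  assert (A : (rho * Cmod u) ^ k / INR (fact k) <= exp (rho * Cmod u)).
  { assert (N : forall j, 0 <= (rho * Cmod u) ^ j / INR (fact j)).
    { intros j. apply Rmult_le_pos.
      - apply pow_le, Rmult_le_pos; [lra | apply Cmod_ge_0].
      - left; apply Rinv_0_lt_compat, INR_fact_lt_0. }
    exact (is_series_term_le _ _ k N (is_series_exp _)). }
  rewrite Rpow_mult_distr in A.
  assert (B : 0 < (/ rho) ^ k) by (apply pow_lt, Rinv_0_lt_compat, Hr).
  assert (D : rho ^ k * (/ rho) ^ k = 1).
  { rewrite <- Rpow_mult_distr, Rinv_r, pow1; lra. }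
  apply Rle_trans with (rho ^ k * Cmod u ^ k / INR (fact k) * (/ rho) ^ k).
  - right. unfold Rdiv. rewrite <- (Rmult_1_l (Cmod u ^ k)) at 1. rewrite <- D. ring.
  - apply Rmult_le_compat_r; lra.
Qed.

Lemma negpow_coef_bound_gen (s0 : C) (x rho : R) (k : nat) :
  0 < rho -> Cmod (negpow_coef s0 k x)
    <= Cmod (negpow s0 x) * exp (rho * Cmod (Clog (RtoC x))) * (/ rho) ^ k.
Proof.
  intros Hr. unfold negpow_coef. rewrite Cmod_mult, Rmult_assoc.
  apply Rmult_le_compat_l; [apply Cmod_ge_0|].
  rewrite <- (Cmod_opp (Clog (RtoC x))). now apply Cmod_pow_fact_le.
Qed.

(** For [x >= 1] the factor [exp (rho * ln x)] is [x] to the power [rho]: a radius [rho] in [s]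
    costs [rho] in the exponent of decay. *)
Lemma negpow_coef_bound (s0 : C) (x rho : R) (k : nat) :
  0 < rho -> 1 <= x -> Cmod (negpow_coef s0 k x) <= Rpower x (- (Re s0 - rho)) * (/ rho) ^ k.
Proof.
  intros Hr Hx. apply Rle_trans with (1 := negpow_coef_bound_gen s0 x rho k Hr).
  right. f_equal. rewrite Cmod_negpow, Clog_pos, Cmod_R by lra.
  assert (L : 0 <= ln x). { rewrite <- ln_1. apply ln_le; lra. }
  rewrite Rabs_pos_eq by trivial. unfold Rpower. rewrite <- exp_plus. f_equal. ring.
Qed.

Lemma RC_continuous_pow (g : R -> C) (q : R) (k : nat) :
  RC_continuous g q -> RC_continuous (fun t => g t ^ k)%C q.
Proof.
  intros H. induction k; simpl; [apply RC_continuous_const | now apply RC_continuous_mult].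
Qed.

Lemma negpow_coef_continuous (s0 : C) (k : nat) (x : R) :
  x <> 0 -> RC_continuous (negpow_coef s0 k) x.
Proof.
  intros H. unfold negpow_coef. apply RC_continuous_mult.
  - eapply is_RC_derive_continuous, negpow_derive, H.
  - apply RC_continuous_mult; [|apply RC_continuous_const].
    apply (RC_continuous_pow (fun t => - Clog (RtoC t))%C).
    eapply is_RC_derive_continuous.
    apply (is_derive_opp (K := R_AbsRing) (V := C_R_NormedModule)). apply Clog_derive, H.
Qed.

(** * Power series depending on a parameter *)

Lemma Rpower_antimono_base (x y p : R) : 0 < x <= y -> 0 <= p -> Rpower y (- p) <= Rpower x (- p).
Proof.
  intros [Hx Hy] Hp. unfold Rpower. apply exp_le_compat.
  assert (ln x <= ln y) by (apply ln_le; lra). nra.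
Qed.

Lemma Rpower_neg_lim (a eps : R) :
  0 < a -> 0 < eps -> exists N, forall n, (N <= n)%nat -> Rpower (INR n + 1) (- a) < eps.
Proof.
  (* [X] solves [X^(-a) = eps]. *)
  intros Ha He. set (X := exp (- ln eps / a)).
  destruct (INR_unbounded X) as [N HN]. exists N. intros n Hn.
  assert (Hn' := le_INR _ _ Hn). assert (P := pos_INR n).
  rewrite <- (exp_ln eps) by trivial. unfold Rpower. apply exp_increasing.
  assert (L : - ln eps / a < ln (INR n + 1)).
  { rewrite <- (ln_exp (- ln eps / a)). apply ln_increasing; [apply exp_pos|]. fold X; lra. }
  apply (Rmult_lt_compat_l a) in L; [|trivial].
  replace (a * (- ln eps / a)) with (- ln eps) in L by (field; lra). lra.
Qed.

Lemma ex_series_Rpower (p : R) : 1 < p -> ex_series (fun n => Rpower (INR n + 1) (- p)).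
Proof.
  intros Hp. set (u := fun n => Rpower (INR n + 1) (- p)).
  assert (Pu : forall n, 0 < u n) by (intros; apply exp_pos).
  (* [g n] is the integral of [y^(-p)] from [n + 1] to infinity; the terms are compared with its
     telescoping differences. *)
  set (g := fun n => Rpower (INR n + 1) (1 - p) / (p - 1)).
  assert (Hg : forall n, u (S n) <= g n - g (S n)).
  { intros n. assert (Pn := pos_INR n). unfold u, g. rewrite S_INR.
    set (f := fun y => - (Rpower y (1 - p) / (p - 1))).
    assert (Df : forall y, 0 < y -> is_derive f y (Rpower y (- p))).
    { intros y Hy. unfold f, Rpower. auto_derive; trivial.
      replace (- p * ln y) with ((1 - p) * ln y + - ln y) by ring.
      rewrite exp_plus, exp_Ropp, exp_ln by trivial. field; lra. }
    destruct (MVT_gen f (INR n + 1) (INR n + 1 + 1) (fun y => Rpower y (- p))) as [c [Hc Ec]].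
    - rewrite Rmin_left, Rmax_right by lra. intros; apply Df; lra.
    - rewrite Rmin_left, Rmax_right by lra. intros; apply continuity_pt_filterlim. eapply is_derive_Rcontinuous, Df; lra.
    - rewrite Rmin_left, Rmax_right in Hc by lra.
      assert (H := Rpower_antimono_base c (INR n + 1 + 1) p ltac:(lra) ltac:(lra)).
      unfold f in Ec. lra. }
  assert (Gp : forall n, 0 < g n).
  { intros. apply Rdiv_lt_0_compat; [apply exp_pos | lra]. }
  destruct (ex_finite_lim_seq_incr (sum_n u) (u O + g O)) as [l Hl].
  - intros n. rewrite sum_Sn. unfold plus; simpl. specialize (Pu (S n)). lra.
  - assert (H : forall n, sum_n u n <= u O + g O - g n).
    { induction n; [rewrite sum_O; lra|]. rewrite sum_Sn. unfold plus; simpl.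
      specialize (Hg n). lra. }
    intros n. specialize (H n); specialize (Gp n); lra.
  - exists l. exact Hl.
Qed.

Lemma in_interval_1 (q : R) : 1 < q -> in_open_interval 1 p_infty q.
Proof. intros H; split; simpl; trivial. Qed.

(** The coefficient bound takes the place of Cauchy's estimate. It dominates the series by a
    geometric one on every smaller disc, with a constant [M] that can be made uniform in a
    parameter. *)
Definition disc_series (F : C -> C) (s0 : C) (c : nat -> C) (rho M : R) : Prop :=
  (forall k, Cmod (c k) <= M * (/ rho) ^ k) /\
  (forall w, Cmod w < rho -> is_Cseries (fun k => c k * w ^ k)%C (F (s0 + w)%C)).

Lemma disc_series_bound_nonneg (F : C -> C) (s0 : C) (c : nat -> C) (rho M : R) :
  disc_series F s0 c rho M -> 0 <= M.
Proof.
  intros [H _]. specialize (H O). simpl in H. assert (A := Cmod_ge_0 (c O)). lra.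
Qed.

Lemma disc_series_shrink (F : C -> C) (s0 : C) (c : nat -> C) (rho rho' M : R) :
  0 < rho' <= rho -> disc_series F s0 c rho M -> disc_series F s0 c rho' M.
Proof.
  intros Hr H. assert (HM := disc_series_bound_nonneg _ _ _ _ _ H). destruct H as [H1 H2].
  split.
  - intros k. apply Rle_trans with (1 := H1 k). apply Rmult_le_compat_l; trivial.
    apply pow_incr. split; [left; apply Rinv_0_lt_compat; lra | apply Rinv_le_contravar; lra].
  - intros w Hw; apply H2; lra.
Qed.

Lemma disc_series_ext (F G : C -> C) (s0 : C) (c : nat -> C) (rho M : R) :
  (forall s, Cmod (s - s0) < rho -> F s = G s) -> disc_series F s0 c rho M -> disc_series G s0 c rho M.
Proof.
  intros E [H1 H2]; split; trivial. intros w Hw. rewrite <- E; auto.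
  replace (s0 + w - s0)%C with w by ring. trivial.
Qed.

Lemma disc_series_plus (F G : C -> C) (s0 : C) (c d : nat -> C) (rho M N : R) :
  disc_series F s0 c rho M -> disc_series G s0 d rho N ->
  disc_series (fun s => F s + G s)%C s0 (fun k => c k + d k)%C rho (M + N).
Proof.
  intros [A1 A2] [B1 B2]; split.
  - intros k. apply Rle_trans with (1 := Cmod_triangle _ _).
    rewrite Rmult_plus_distr_r. apply Rplus_le_compat; auto.
  - intros w Hw. apply is_Cseries_ext with (fun k => c k * w ^ k + d k * w ^ k)%C.
    + intros; ring.
    + apply is_Cseries_plus; auto.
Qed.

Lemma disc_series_cmult (F : C -> C) (s0 a : C) (c : nat -> C) (rho M : R) :
  disc_series F s0 c rho M ->
  disc_series (fun s => a * F s)%C s0 (fun k => a * c k)%C rho (Cmod a * M).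
Proof.
  intros [A1 A2]; split.
  - intros k. rewrite Cmod_mult, Rmult_assoc. apply Rmult_le_compat_l; [apply Cmod_ge_0 | auto].
  - intros w Hw. apply is_Cseries_ext with (fun k => a * (c k * w ^ k))%C.
    + intros; ring.
    + apply is_Cseries_cmult; auto.
Qed.

Definition shift_coef (c : nat -> C) (k : nat) : C :=
  match k with O => RtoC 0 | S j => c j end.

Lemma disc_series_mult_var (F : C -> C) (s0 : C) (c : nat -> C) (rho M : R) :
  0 < rho -> disc_series F s0 c rho M ->
  disc_series (fun s => (s - s0) * F s)%C s0 (shift_coef c) rho (M * rho).
Proof.
  intros Hr H. assert (HM := disc_series_bound_nonneg _ _ _ _ _ H). destruct H as [H1 H2].
  split.
  - intros [|k]; simpl.
    + rewrite Cmod_0. nra.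
    + replace (M * rho * (/ rho * (/ rho) ^ k)) with (M * (/ rho) ^ k); [auto|].
      field; lra.
  - intros w Hw. replace ((s0 + w - s0) * F (s0 + w))%C with (shift_coef c 0 * w ^ 0 + w * F (s0 + w))%C
      by (simpl; ring).
    apply is_Cseries_decr_1. simpl.
    apply is_Cseries_ext with (fun k => w * (c k * w ^ k))%C; [intros; ring|].
    apply is_Cseries_cmult; auto.
Qed.

Lemma disc_series_mult_linear (F : C -> C) (s0 a : C) (c : nat -> C) (rho M : R) :
  0 < rho -> disc_series F s0 c rho M ->
  disc_series (fun s => (s - a) * F s)%C s0 (fun k => (s0 - a) * c k + shift_coef c k)%C rho
    (Cmod (s0 - a) * M + M * rho).
Proof.
  intros Hr H.
  apply (disc_series_ext (fun s => (s0 - a) * F s + (s - s0) * F s)%C).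
  - intros; ring.
  - apply disc_series_plus; [now apply disc_series_cmult | now apply disc_series_mult_var].
Qed.

Lemma disc_series_shift (F : C -> C) (s0 a : C) (c : nat -> C) (rho M : R) :
  disc_series F (s0 + a) c rho M -> disc_series (fun s => F (s + a))%C s0 c rho M.
Proof.
  intros [H1 H2]; split; trivial. intros w Hw.
  replace (s0 + w + a)%C with (s0 + a + w)%C by ring. auto.
Qed.

Lemma ex_series_geom_scal (M x : R) : Rabs x < 1 -> ex_series (fun k => M * x ^ k).
Proof.
  intros H. eexists. apply (is_series_scal (K := R_AbsRing) (V := R_NormedModule)).
  apply is_series_geom, H.
Qed.

Lemma disc_series_term_bound (F : C -> C) (s0 w : C) (c : nat -> C) (rho M : R) (k : nat) :
  disc_series F s0 c rho M -> Cmod (c k * w ^ k) <= M * (Cmod w / rho) ^ k.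
Proof.
  intros [H _]. rewrite Cmod_mult, Cmod_pow. unfold Rdiv. rewrite Rpow_mult_distr.
  replace (M * (Cmod w ^ k * (/ rho) ^ k)) with (M * (/ rho) ^ k * Cmod w ^ k) by ring.
  apply Rmult_le_compat_r; auto. apply pow_le, Cmod_ge_0.
Qed.

(* The bounds are uniform in [q < B] so that the power series may be integrated in [q]. *)
Definition analytic_family (F : C -> R -> C) (s0 : C) : Prop :=
  exists (rho : R) (c : nat -> R -> C), 0 < rho /\
    (forall k q, 1 < q -> RC_continuous (c k) q) /\
    (forall B, exists M, forall q, 1 < q < B ->
       disc_series (fun s => F s q) s0 (fun k => c k q) rho M).

Lemma analytic_family_ext (F G : C -> R -> C) (s0 : C) (sigma : R) :
  sigma < Re s0 -> (forall s q, sigma < Re s -> 1 < q -> F s q = G s q) ->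
  analytic_family F s0 -> analytic_family G s0.
Proof.
  intros Hs E (rho & c & Hr & Hc & HB).
  (* The radius shrinks so that the disc stays inside the half-plane where [F] and [G] agree. *)
  set (rho' := Rmin rho (Re s0 - sigma)).
  assert (Hr' : 0 < rho' <= rho /\ rho' <= Re s0 - sigma).
  { split; [split; [apply Rmin_glb_lt; lra | apply Rmin_l] | apply Rmin_r]. }
  exists rho', c. split; [lra|]. split; trivial.
  intros B; destruct (HB B) as [M HM]; exists M. intros q Hq.
  apply (disc_series_ext (fun s => F s q)).
  - intros s Hs'. apply E; [|lra].
    assert (A := re_le_Cmod (s - s0)). apply Rabs_le_between in A.
    unfold Re in *; simpl in A. lra.
  - apply disc_series_shrink with rho; [lra | auto].
Qed.

Lemma analytic_family_plus (F G : C -> R -> C) (s0 : C) :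
  analytic_family F s0 -> analytic_family G s0 -> analytic_family (fun s q => F s q + G s q)%C s0.
Proof.
  intros (r1 & c1 & Hr1 & Hc1 & HB1) (r2 & c2 & Hr2 & Hc2 & HB2).
  exists (Rmin r1 r2), (fun k q => c1 k q + c2 k q)%C.
  assert (P : 0 < Rmin r1 r2) by now apply Rmin_glb_lt.
  assert (P1 := Rmin_l r1 r2). assert (P2 := Rmin_r r1 r2).
  split; trivial. split.
  - intros; apply RC_continuous_plus; auto.
  - intros B. destruct (HB1 B) as [M1 H1], (HB2 B) as [M2 H2]. exists (M1 + M2). intros q Hq.
    apply (disc_series_plus (fun s => F s q) (fun s => G s q));
      [apply disc_series_shrink with r1 | apply disc_series_shrink with r2]; auto.
Qed.

Lemma analytic_family_cmult (a : C) (F : C -> R -> C) (s0 : C) :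
  analytic_family F s0 -> analytic_family (fun s q => a * F s q)%C s0.
Proof.
  intros (r & c & Hr & Hc & HB). exists r, (fun k q => a * c k q)%C.
  split; trivial. split.
  - intros; apply RC_continuous_mult; [apply RC_continuous_const | auto].
  - intros B. destruct (HB B) as [M H]. exists (Cmod a * M). intros q Hq.
    apply (disc_series_cmult (fun s => F s q)); auto.
Qed.

Lemma analytic_family_mult_linear (a : C) (F : C -> R -> C) (s0 : C) :
  analytic_family F s0 -> analytic_family (fun s q => (s - a) * F s q)%C s0.
Proof.
  intros (r & c & Hr & Hc & HB).
  exists r, (fun k q => (s0 - a) * c k q + shift_coef (fun k => c k q) k)%C.
  split; trivial. split.
  - intros k q Hq. apply RC_continuous_plus.
    + apply RC_continuous_mult; [apply RC_continuous_const | auto].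
    + destruct k; simpl; [apply RC_continuous_const | now apply Hc].
  - intros B. destruct (HB B) as [M H]. eexists. intros q Hq.
    apply (disc_series_mult_linear (fun s => F s q)); auto.
Qed.

Lemma analytic_family_shift (a : C) (F : C -> R -> C) (s0 : C) :
  analytic_family F (s0 + a) -> analytic_family (fun s q => F (s + a)%C q) s0.
Proof.
  intros (r & c & Hr & Hc & HB). exists r, c. split; trivial. split; trivial.
  intros B. destruct (HB B) as [M H]. exists M. intros q Hq.
  apply (disc_series_shift (fun s => F s q)); auto.
Qed.

Lemma RC_continuous_translate (g : R -> C) (a q : R) :
  RC_continuous g (q + a) -> RC_continuous (fun t => g (t + a)) q.
Proof.
  intros [H1 H2].
  assert (T : continuous (fun t : R => t + a) q).
  { apply (is_derive_Rcontinuous _ _ 1). auto_derive; trivial. }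
  split; [exact (continuous_comp (fun t => t + a) (fun t => Re (g t)) q T H1)
         | exact (continuous_comp (fun t => t + a) (fun t => Im (g t)) q T H2)].
Qed.

Lemma analytic_family_translate (a : R) (F : C -> R -> C) (s0 : C) :
  0 <= a -> analytic_family F s0 -> analytic_family (fun s q => F s (q + a)) s0.
Proof.
  intros Ha (r & c & Hr & Hc & HB). exists r, (fun k q => c k (q + a)). split; trivial. split.
  - intros k q Hq. apply RC_continuous_translate, Hc. lra.
  - intros B. destruct (HB (B + a)) as [M H]. exists M. intros q Hq. apply H. lra.
Qed.

(** The base point 2 is an arbitrary point above 1: the constants of integration cancel in
    [taylor_op]. *)
Notation prim := (RC_prim 2).

Lemma prim_correct (g : R -> C) :
  (forall q, 1 < q -> RC_continuous g q) -> is_primitive_on 1 p_infty (prim g) g.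
Proof.
  intros H. apply RC_prim_correct; [apply in_interval_1; lra|]. intros q [Hq _]. now apply H.
Qed.

Lemma prim_eq (g G : R -> C) (q : R) :
  (forall q, 1 < q -> RC_continuous g q) -> is_primitive_on 1 p_infty G g -> 1 < q ->
  prim g q = (G q - G 2)%C.
Proof.
  intros Hg HG Hq.
  rewrite <- (primitive_unique 1 p_infty (prim g) G g 2 q); trivial.
  - rewrite RC_prim_point. ring.
  - now apply prim_correct.
  - apply in_interval_1; lra.
  - now apply in_interval_1.
Qed.

Lemma prim_continuous (g : R -> C) (q : R) :
  (forall q, 1 < q -> RC_continuous g q) -> 1 < q -> RC_continuous (prim g) q.
Proof.
  intros H Hq. eapply is_RC_derive_continuous, prim_correct; trivial. now apply in_interval_1.
Qed.

Lemma prim_cmult (c : C) (g : R -> C) (q : R) :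
  (forall q, 1 < q -> RC_continuous g q) -> 1 < q -> prim (fun t => c * g t)%C q = (c * prim g q)%C.
Proof.
  intros H Hq. rewrite (prim_eq _ (fun t => c * prim g t)%C); trivial.
  - rewrite RC_prim_point. ring.
  - intros; apply RC_continuous_mult; [apply RC_continuous_const | auto].
  - intros t Ht. apply is_RC_derive_cmult. now apply prim_correct.
Qed.

Lemma prim_ext (f g : R -> C) (q : R) :
  (forall t, 1 < t -> f t = g t) -> 1 < q -> prim f q = prim g q.
Proof.
  intros H Hq.
  assert (A : forall t, Rmin 2 q < t < Rmax 2 q -> 1 < t).
  { intros t [Ht _]. apply Rle_lt_trans with (2 := Ht). apply Rmin_glb; lra. }
  unfold RC_prim. f_equal; apply RInt_ext; intros t Ht; now rewrite H by auto.
Qed.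

(** The value at [s0] is the sum of the power series at [w = 0], a dominated series of continuous
    functions; the bound [q + 1] only provides a neighbourhood of [q]. *)
Lemma analytic_family_continuous (F : C -> R -> C) (s0 : C) (q : R) :
  analytic_family F s0 -> 1 < q -> RC_continuous (F s0) q.
Proof.
  intros (r & c & Hr & Hc & HB) Hq. destruct (HB (q + 1)) as [M HM].
  assert (Z : Cmod 0 / r = 0) by (rewrite Cmod_0; field; lra).
  apply (RC_continuous_dominated_series 1 (q + 1) (fun k t => c k t * 0 ^ k)%C _ (fun k => M * (Cmod 0 / r) ^ k)).
  - apply ex_series_geom_scal. rewrite Z, Rabs_R0; lra.
  - intros n t Ht. exact (disc_series_term_bound _ s0 _ (fun k => c k t) r M n (HM t Ht)).
  - intros n t [Ht _]. apply RC_continuous_mult; [now apply Hc | apply RC_continuous_const].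
  - intros t Ht. replace s0 with (s0 + 0)%C by ring. apply HM; trivial. rewrite Cmod_0; trivial.
  - split; simpl; lra.
Qed.

Lemma analytic_family_prim (F : C -> R -> C) (s0 : C) :
  analytic_family F s0 -> analytic_family (fun s => prim (F s)) s0.
Proof.
  intros (r & c & Hr & Hc & HB). exists r, (fun k => prim (c k)). split; trivial. split.
  - intros k q Hq. apply prim_continuous; auto.
  (* The interval up to [B'] must contain the base point 2 as well as [q]. *)
  - intros B. set (B' := Rmax B 3). assert (HB1 := Rmax_l B 3). assert (HB2 := Rmax_r B 3).
    fold B' in HB1, HB2.
    destruct (HB B') as [M HM]. exists (M * B'). intros q Hq.
    assert (M0 : 0 <= M) by (eapply disc_series_bound_nonneg, (HM 2); lra).
    split.
    + intros k.
      replace (prim (c k) q) with (prim (c k) q - prim (c k) 2)%C by (rewrite RC_prim_point; ring).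
      apply Rle_trans with (M * (/ r) ^ k * Rabs (q - 2)).
      * apply (RC_lipschitz 1 B' (prim (c k)) (c k)).
        -- intros t [Ht _]. apply prim_correct; auto. now apply in_interval_1.
        -- intros t Ht. apply (HM t Ht).
        -- split; simpl; lra.
        -- split; simpl; lra.
      * assert (Q : 0 <= M * (/ r) ^ k).
        { apply Rmult_le_pos; trivial. apply pow_le. left; now apply Rinv_0_lt_compat. }
        replace (M * B' * (/ r) ^ k) with (M * (/ r) ^ k * B') by ring.
        apply Rmult_le_compat_l; trivial. apply Rabs_le_between. lra.
    + intros w Hw.
      apply is_Cseries_ext with (fun k => prim (fun t => c k t * w ^ k)%C q).
      { intros k. rewrite (prim_ext _ (fun t => w ^ k * c k t)%C) by (intros; ring || lra).
        rewrite prim_cmult by (auto; lra). ring. }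
      apply (RC_prim_series 1 B' 2 (fun k t => c k t * w ^ k)%C _ (fun k => M * (Cmod w / r) ^ k)); try lra.
      * apply ex_series_geom_scal. rewrite Rabs_pos_eq.
        -- apply Rmult_lt_reg_r with r; trivial. field_simplify; lra.
        -- apply Rmult_le_pos; [apply Cmod_ge_0 | left; now apply Rinv_0_lt_compat].
      * intros n t Ht. exact (disc_series_term_bound _ s0 _ (fun k => c k t) r M n (HM t Ht)).
      * intros n t Ht. apply RC_continuous_mult; [apply Hc; lra | apply RC_continuous_const].
      * intros t Ht. now apply HM.
Qed.

Lemma analytic_family_negpow (s0 : C) : analytic_family negpow s0.
Proof.
  exists 1, (negpow_coef s0). split; [lra|]. split.
  - intros k q Hq. apply negpow_coef_continuous; lra.
  (* Bounds [q^(1 - Re s0)] for [1 < q < B], whatever the sign of the exponent. *)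
  - intros B. exists (exp (Rabs (Re s0 - 1) * ln B)). intros q Hq. split.
    + intros k. apply Rle_trans with (1 := negpow_coef_bound s0 q 1 k ltac:(lra) ltac:(lra)).
      apply Rmult_le_compat_r; [apply pow_le; lra|].
      unfold Rpower. apply exp_le_compat.
      assert (L0 : 0 <= ln q) by (rewrite <- ln_1; apply ln_le; lra).
      assert (L1 : ln q <= ln B) by (apply ln_le; lra).
      apply Rle_trans with (Rabs (Re s0 - 1) * ln q).
      * apply Rmult_le_compat_r; trivial. rewrite <- Rabs_Ropp. apply Rle_abs.
      * apply Rmult_le_compat_l; trivial. apply Rabs_pos.
    + intros w _. apply negpow_series.
Qed.

(** * The Hurwitz series in its half-plane of convergence *)

Definition hsum (s : C) (x : R) : C := Cseries (fun n => negpow s (INR n + x)).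

Lemma Cmod_negpow_le (s : C) (p x : R) (n : nat) :
  0 <= p <= Re s -> 1 < x -> Cmod (negpow s (INR n + x)) <= Rpower (INR n + 1) (- p).
Proof.
  intros Hp Hx. assert (P := pos_INR n). rewrite Cmod_negpow by lra.
  apply Rle_trans with (Rpower (INR n + 1) (- Re s)).
  - apply Rpower_antimono_base; lra.
  - apply Rle_Rpower; lra.
Qed.

Lemma hsum_correct (s : C) (x : R) :
  1 < Re s -> 1 < x -> is_Cseries (fun n => negpow s (INR n + x)) (hsum s x).
Proof.
  intros Hs Hx. apply (Cseries_correct _ (fun n => Rpower (INR n + 1) (- Re s))).
  - intros n. apply Cmod_negpow_le; lra.
  - now apply ex_series_Rpower.
Qed.

(** Each term is a power series in [s]; exchanging the two summations gives one power series whose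
    coefficients are sums over [n]. *)
Lemma analytic_family_hsum (s0 : C) : 1 < Re s0 -> analytic_family hsum s0.
Proof.
  (* Half the distance to the line [Re s = 1]: the loss of [rho] in the exponent leaves [p] above
     1. *)
  intros Hs. set (rho := (Re s0 - 1) / 2). set (p := Re s0 - rho).
  assert (Hr : 0 < rho) by (unfold rho; lra). assert (Hp : 1 < p) by (unfold p, rho; lra).
  assert (Hir : 0 < / rho) by now apply Rinv_0_lt_compat.
  destruct (ex_series_Rpower p Hp) as [A HA].
  assert (Hb : forall n k q, 1 < q ->
     Cmod (negpow_coef s0 k (INR n + q)) <= Rpower (INR n + 1) (- p) * (/ rho) ^ k).
  { intros n k q Hq. assert (P := pos_INR n).
    apply Rle_trans with (1 := negpow_coef_bound s0 (INR n + q) rho k Hr ltac:(lra)).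
    apply Rmult_le_compat_r; [apply pow_le; lra|]. fold p. apply Rpower_antimono_base; lra. }
  assert (Hex : forall k, ex_series (fun n => Rpower (INR n + 1) (- p) * (/ rho) ^ k)).
  { intros k. apply ex_series_scal_r. now exists A. }
  assert (Hcol : forall k q, 1 < q -> is_Cseries (fun n => negpow_coef s0 k (INR n + q))
     (Cseries (fun n => negpow_coef s0 k (INR n + q)))).
  { intros k q Hq. eapply Cseries_correct; [intros; now apply Hb | apply Hex]. }
  exists rho, (fun k q => Cseries (fun n => negpow_coef s0 k (INR n + q))).
  split; trivial. split.
  - intros k q Hq.
    apply (RC_continuous_dominated_series 1 p_infty (fun n q => negpow_coef s0 k (INR n + q)) _
             (fun n => Rpower (INR n + 1) (- p) * (/ rho) ^ k)); trivial.
    + intros n t [Ht _]. now apply Hb.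
    + intros n t [Ht _]. simpl in Ht. assert (P := pos_INR n).
      destruct (RC_continuous_translate (negpow_coef s0 k) (INR n) t) as [U V].
      { apply negpow_coef_continuous. lra. }
      split; [eapply continuous_ext, U | eapply continuous_ext, V]; intros y; now rewrite Rplus_comm.
    + intros t [Ht _]. now apply Hcol.
    + now apply in_interval_1.
  - intros B. exists A. intros q Hq. split.
    + intros k.
      apply (Cmod_is_Cseries (fun n => negpow_coef s0 k (INR n + q)) _ _ _ (fun n => Hb n k q (proj1 Hq)));
        [apply Hcol; lra|].
      apply is_series_scal_r, HA.
    + intros w Hw.
      apply (double_Cseries_swap (fun n k => negpow_coef s0 k (INR n + q) * w ^ k)%C
        (fun n => Rpower (INR n + 1) (- p)) (fun k => (Cmod w / rho) ^ k)
        (fun n => negpow (s0 + w) (INR n + q))).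
      * now exists A.
      * destruct (ex_series_geom_scal 1 (Cmod w / rho)) as [l Hl].
        -- rewrite Rabs_pos_eq.
           ++ apply Rmult_lt_reg_r with rho; trivial. field_simplify; lra.
           ++ apply Rmult_le_pos; [apply Cmod_ge_0 | lra].
        -- exists l. apply is_series_ext with (2 := Hl). intros; apply Rmult_1_l.
      * intros n k. rewrite Cmod_mult, Cmod_pow. unfold Rdiv. rewrite Rpow_mult_distr.
        replace (Rpower (INR n + 1) (- p) * (Cmod w ^ k * (/ rho) ^ k))
          with (Rpower (INR n + 1) (- p) * (/ rho) ^ k * Cmod w ^ k) by ring.
        apply Rmult_le_compat_r; [apply pow_le, Cmod_ge_0 | apply Hb; lra].
      * intros n. apply negpow_series.
      * intros k. apply is_Cseries_ext with (fun n => w ^ k * negpow_coef s0 k (INR n + q))%C.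
        { intros; ring. }
        rewrite Cmult_comm. apply is_Cseries_cmult, Hcol. lra.
      * apply hsum_correct; [|lra].
        assert (W := re_le_Cmod w). apply Rabs_le_between in W.
        unfold Re in *; simpl. unfold rho in Hw. lra.
Qed.

Lemma negpow_translate_derive (s : C) (a x : R) :
  0 < a + x -> is_RC_derive (fun t => negpow s (a + t)) x (- s * negpow (s + 1) (a + x))%C.
Proof.
  intros H.
  apply (is_RC_derive_ext (fun t => negpow s (a + 1 * t))).
  { intros t. now rewrite Rmult_1_l. }
  eapply is_RC_derive_eq.
  - apply (is_RC_derive_comp_affine (negpow s) a 1 x). apply negpow_derive. lra.
  - rewrite Rmult_1_l. ring.
Qed.

Lemma prim_negpow (s : C) (a q : R) :
  0 <= a -> 1 < q ->
  prim (fun t => - s * negpow (s + 1) (a + t))%C q = (negpow s (a + q) - negpow s (a + 2))%C.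
Proof.
  intros Ha Hq. apply (prim_eq _ (fun t => negpow s (a + t))); trivial.
  - intros t Ht. apply RC_continuous_mult; [apply RC_continuous_const|].
    eapply is_RC_derive_continuous, negpow_translate_derive. lra.
  - intros t [Ht _]. simpl in Ht. apply negpow_translate_derive. lra.
Qed.

(** Only [Re s > 0] is assumed, so the series of [negpow s (INR n + q)] may diverge; the differences
    from the base point 2 still have a convergent sum. This allows the use at [s - 1] below. *)
Lemma prim_hsum (s : C) (q : R) :
  0 < Re s -> 1 < q ->
  is_Cseries (fun n => negpow s (INR n + q) - negpow s (INR n + 2))%C
    (prim (fun t => - s * hsum (s + 1) t)%C q).
Proof.
  intros Hs Hq. assert (Hs1 : 1 < Re (s + 1)) by (unfold Re in *; simpl; lra).
  apply is_Cseries_ext with (fun n => prim (fun t => - s * negpow (s + 1) (INR n + t))%C q).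
  { intros n. apply prim_negpow; trivial. apply pos_INR. }
  (* The upper end [q + 2] makes both 2 and [q] interior points. *)
  apply (RC_prim_series 1 (q + 2) 2 (fun n t => - s * negpow (s + 1) (INR n + t))%C _
    (fun n => Cmod (- s) * Rpower (INR n + 1) (- Re (s + 1)))); try lra.
  - apply (ex_series_scal (K := R_AbsRing) (V := R_NormedModule)). now apply ex_series_Rpower.
  - intros n t Ht. rewrite Cmod_mult. apply Rmult_le_compat_l; [apply Cmod_ge_0|].
    apply Cmod_negpow_le; lra.
  - intros n t Ht. apply RC_continuous_mult; [apply RC_continuous_const|].
    eapply is_RC_derive_continuous, negpow_translate_derive. assert (P := pos_INR n). lra.
  - intros t Ht. apply is_Cseries_cmult, hsum_correct; lra.
Qed.

(** Termwise integration exhibits [hsum s] as a primitive of the proposed derivative plus the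
    constant [hsum s 2]. *)
Lemma hsum_derive (s : C) (q : R) :
  1 < Re s -> 1 < q -> is_RC_derive (hsum s) q (- s * hsum (s + 1) q)%C.
Proof.
  intros Hs Hq. assert (Hs1 : 1 < Re (s + 1)) by (unfold Re in *; simpl; lra).
  apply (is_RC_derive_ext_loc (fun t => prim (fun t => - s * hsum (s + 1) t)%C t + hsum s 2)%C).
  - generalize (open_gt 1 q Hq). apply filter_imp. intros t Ht.
    apply (is_Cseries_unique (fun n => negpow s (INR n + t) - negpow s (INR n + 2) + negpow s (INR n + 2))%C).
    + apply is_Cseries_plus; [apply prim_hsum; trivial; lra | apply hsum_correct; lra].
    + apply is_Cseries_ext with (2 := hsum_correct s t Hs Ht). intros; ring.
  - eapply is_RC_derive_eq.
    + apply is_RC_derive_plus; [|apply is_RC_derive_const].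
      apply prim_correct; [|now apply in_interval_1].
      intros t Ht. apply RC_continuous_mult; [apply RC_continuous_const|].
      apply analytic_family_continuous; trivial. now apply analytic_family_hsum.
    + ring.
Qed.

(** Termwise integration over the unit interval gives a telescoping sum whose last term tends to 0
    because [Re (s - 1) > 0]. This supplies the [negpow] term of [continuation_step]. *)
Lemma prim_hsum_difference (s : C) (q : R) :
  1 < Re s -> 1 < q ->
  let h := fun t => ((s - 1) * hsum s t)%C in
  (prim h (q + 1) - prim h q)%C = negpow (s - 1) q.
Proof.
  intros Hs Hq h. assert (Hs1 : 0 < Re (s - 1)) by (unfold Re in *; simpl; lra).
  set (s' := (s - 1)%C) in *.
  assert (E : forall x, 1 < x -> prim h x = (- 1 * prim (fun t => - s' * hsum (s' + 1) t) x)%C).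
  { intros x Hx. rewrite <- prim_cmult; trivial.
    - apply prim_ext; trivial. intros t Ht. unfold h.
      replace (s' + 1)%C with s by (unfold s'; ring). ring.
    - intros t Ht. apply RC_continuous_mult; [apply RC_continuous_const|].
      apply analytic_family_continuous; trivial. apply analytic_family_hsum.
      unfold Re in *; simpl in *; lra. }
  rewrite !E by lra.
  apply (is_Cseries_unique (fun n => negpow s' (INR n + q) - negpow s' (INR (S n) + q))%C).
  - apply is_Cseries_ext with (fun n =>
      -1 * (negpow s' (INR n + (q + 1)) - negpow s' (INR n + 2))
      - -1 * (negpow s' (INR n + q) - negpow s' (INR n + 2)))%C.
    + intros n. rewrite S_INR. replace (INR n + (q + 1)) with (INR n + 1 + q) by ring. ring.
    + apply is_Cseries_minus; apply is_Cseries_cmult, prim_hsum; lra.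
  - apply is_Cseries_eps. intros eps He.
    destruct (Rpower_neg_lim (Re s') eps Hs1 He) as [N HN]. exists N. intros n Hn.
    assert (T : forall n, Csum_n (fun n => negpow s' (INR n + q) - negpow s' (INR (S n) + q))%C n
                 = (negpow s' q - negpow s' (INR (S n) + q))%C :> C).
    { clear. induction n.
      - rewrite sum_O. simpl INR. now rewrite Rplus_0_l.
      - rewrite Csum_n_S, IHn. ring. }
    rewrite T. replace (negpow s' q - negpow s' (INR (S n) + q) - negpow s' q)%C
      with (- negpow s' (INR (S n) + q))%C by ring.
    rewrite Cmod_opp. apply Rle_lt_trans with (2 := HN (S n) ltac:(lia)).
    apply Cmod_negpow_le; lra.
Qed.

(** * Analytic continuation of the Hurwitz zeta function *)

(* By Taylor's formula this is [RInt (fun x => (q + 1 - x) * h x) q (q + 1)]. *)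
Definition taylor_op (h : R -> C) (q : R) : C :=
  (prim (prim h) (q + 1) - prim (prim h) q - prim h q)%C.

Lemma taylor_op_ext (f g : R -> C) (q : R) :
  (forall t, 1 < t -> f t = g t) -> 1 < q -> taylor_op f q = taylor_op g q.
Proof.
  intros H Hq. unfold taylor_op.
  assert (E : forall t, 1 < t -> prim f t = prim g t) by (intros; now apply prim_ext).
  rewrite E, !(prim_ext _ _ _ E) by lra. reflexivity.
Qed.

Lemma taylor_op_cmult (c : C) (h : R -> C) (q : R) :
  (forall q, 1 < q -> RC_continuous h q) -> 1 < q ->
  taylor_op (fun t => c * h t)%C q = (c * taylor_op h q)%C.
Proof.
  intros H Hq. unfold taylor_op.
  assert (E : forall t, 1 < t -> prim (fun t => c * h t)%C t = (c * prim h t)%C)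
    by (intros; now apply prim_cmult).
  rewrite E, !(prim_ext _ _ _ E), !prim_cmult by (lra || (intros; apply prim_continuous; trivial)).
  ring.
Qed.

Lemma taylor_op_derive (h : R -> C) (q : R) :
  (forall q, 1 < q -> RC_continuous h q) -> 1 < q ->
  is_RC_derive (taylor_op h) q (prim h (q + 1) - prim h q - h q)%C.
Proof.
  intros H Hq.
  assert (H2 : is_primitive_on 1 p_infty (prim (prim h)) (prim h)).
  { apply prim_correct. intros; now apply prim_continuous. }
  apply is_RC_derive_minus; [apply is_RC_derive_minus|].
  - apply (is_RC_derive_ext (fun t => prim (prim h) (1 + 1 * t))).
    { intros t. f_equal. ring. }
    eapply is_RC_derive_eq.
    + apply is_RC_derive_comp_affine, H2, in_interval_1. lra.
    + replace (1 + 1 * q) with (q + 1) by ring. ring.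
  - apply H2. now apply in_interval_1.
  - apply prim_correct; trivial. now apply in_interval_1.
Qed.

(** Integration by parts against the kernel [q + 1 - x]. The right-hand side is also the derivative
    found in [taylor_op_derive], so [taylor_op] commutes with differentiation; this lets a
    continuation step preserve the derivative relation. *)
Lemma taylor_op_of_derivative (h h' : R -> C) (q : R) :
  is_primitive_on 1 p_infty h h' ->
  (forall q, 1 < q -> RC_continuous h' q) -> 1 < q ->
  taylor_op h' q = (prim h (q + 1) - prim h q - h q)%C.
Proof.
  intros Hh Hc Hq.
  assert (Hch : forall t, 1 < t -> RC_continuous h t).
  { intros t Ht. eapply is_RC_derive_continuous, Hh. now apply in_interval_1. }
  assert (E : forall t, 1 < t -> prim h' t = (h t - h 2)%C) by (intros; now apply prim_eq).
  (* The constant [h 2] in [E] becomes a linear term here; it cancels in [taylor_op]. *)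
  assert (E2 : forall t, 1 < t -> prim (prim h') t = (prim h t - RtoC (t - 2) * h 2)%C).
  { intros t Ht. rewrite (prim_eq _ (fun t => prim h t - RtoC (t - 2) * h 2)%C); trivial.
    - rewrite RC_prim_point. replace (2 - 2) with 0 by ring. ring.
    - intros; now apply prim_continuous.
    - intros x Hx. eapply is_RC_derive_eq.
      + apply is_RC_derive_minus; [apply prim_correct; trivial|].
        apply is_RC_derive_mult; [|apply is_RC_derive_const].
        apply (is_RC_derive_RtoC _ _ 1). auto_derive; trivial.
      + rewrite E by apply Hx. ring. }
  unfold taylor_op. rewrite !E2, E by lra.
  rewrite !RtoC_minus, RtoC_plus. ring.
Qed.

(* Reaches one unit further to the left: with [F s q = (s - 1) * zeta(s, q)] this is the identity
   [zeta(s, q) = q^(1-s) / (s-1) + s * integral_q^(q+1) (q + 1 - x) * zeta(s+1, x) dx]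
   multiplied by [s - 1], which removes the poles at [s = 1] and [s + 1 = 1]. *)
Definition continuation_step (F : C -> R -> C) (s : C) (q : R) : C :=
  (negpow (s - 1) q + (s - 1) * taylor_op (F (s + 1)%C) q)%C.

(** The third clause says that a step reproduces [F] where [F] is already known, which makes
    successive continuations agree. In the second, [F (s + 1)] already contains the factor [s] of
    the derivative of zeta, which leaves [s - 1]. *)
Definition zeta_like (F : C -> R -> C) (sigma : R) : Prop :=
  (forall s, sigma < Re s -> analytic_family F s) /\
  (forall s q, sigma < Re s -> 1 < q -> is_RC_derive (F s) q (- (s - 1) * F (s + 1) q)%C) /\
  (forall s q, sigma < Re s -> 1 < q -> continuation_step F s q = F s q).

Lemma Re_plus1 (s : C) : Re (s + 1)%C = Re s + 1.
Proof. unfold Re; simpl. ring. Qed.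

Lemma zeta_like_step (F : C -> R -> C) (sigma : R) :
  zeta_like F sigma -> zeta_like (continuation_step F) (sigma - 1).
Proof.
  intros (HA & HD & HS). split; [|split].
  - intros s Hs. assert (Hs1 : sigma < Re (s + 1)) by (rewrite Re_plus1; lra).
    assert (A1 : analytic_family (fun s => F (s + 1)%C) s) by (apply analytic_family_shift, HA, Hs1).
    assert (P1 := analytic_family_prim _ _ A1). assert (P2 := analytic_family_prim _ _ P1).
    unfold continuation_step. apply (analytic_family_plus (fun s q => negpow (s - 1) q)).
    + apply (analytic_family_shift (- (1))%C negpow). apply analytic_family_negpow.
    + apply (analytic_family_mult_linear 1 (fun s q => taylor_op (F (s + 1)%C) q)).
      apply (analytic_family_plus (fun s q => prim (prim (F (s + 1)%C)) (q + 1) - prim (prim (F (s + 1)%C)) q)%C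
               (fun s q => - prim (F (s + 1)%C) q)%C).
      * apply (analytic_family_plus (fun s q => prim (prim (F (s + 1)%C)) (q + 1))
                 (fun s q => - prim (prim (F (s + 1)%C)) q)%C).
        -- apply (analytic_family_translate 1 (fun s => prim (prim (F (s + 1)%C)))); [lra | trivial].
        -- apply (analytic_family_ext (fun s q => - (1) * prim (prim (F (s + 1)%C)) q)%C _ _ (Re s - 1));
             [lra | intros; ring | now apply analytic_family_cmult].
      * apply (analytic_family_ext (fun s q => - (1) * prim (F (s + 1)%C) q)%C _ _ (Re s - 1));
             [lra | intros; ring | now apply analytic_family_cmult].
  - intros s q Hs Hq. assert (Hs1 : sigma < Re (s + 1)) by (rewrite Re_plus1; lra).
    assert (Hs2 : sigma < Re (s + 1 + 1)) by (rewrite !Re_plus1; lra).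
    assert (C1 : forall q, 1 < q -> RC_continuous (F (s + 1)%C) q)
      by (intros; apply analytic_family_continuous; auto).
    assert (C2 : forall q, 1 < q -> RC_continuous (F (s + 1 + 1)%C) q)
      by (intros; apply analytic_family_continuous; auto).
    eapply is_RC_derive_eq.
    + apply is_RC_derive_plus; [apply negpow_derive; lra|].
      apply is_RC_derive_cmult, taylor_op_derive; trivial.
    (* The difference of primitives is [taylor_op] applied to the derivative of [F (s + 1)], that
       is, to [- s * F (s + 1 + 1)]; together with the [negpow] term it forms the continuation step
       at [s + 1]. *)
    + rewrite <- (taylor_op_of_derivative (F (s + 1)%C) (fun t => - (s + 1 - 1) * F (s + 1 + 1) t)%C); trivial.
      * rewrite taylor_op_cmult by trivial. unfold continuation_step.
        replace (s - 1 + 1)%C with s by ring. replace (s + 1 - 1)%C with s by ring. ring.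
      * intros t [Ht _]. now apply HD.
      * intros t Ht. apply RC_continuous_mult; [apply RC_continuous_const | auto].
  - intros s q Hs Hq. assert (Hs1 : sigma < Re (s + 1)) by (rewrite Re_plus1; lra).
    (* Both sides use values at [s + 1] only, where the step is already known to reproduce [F]. *)
    unfold continuation_step at 1 3. f_equal. f_equal. apply taylor_op_ext; trivial.
    intros t Ht. now apply HS.
Qed.

Fixpoint reg_zeta_upto (K : nat) : C -> R -> C :=
  match K with
  | O => fun s q => ((s - 1) * hsum s q)%C
  | S K' => continuation_step (reg_zeta_upto K')
  end.

Lemma zeta_like_upto (K : nat) : zeta_like (reg_zeta_upto K) (1 - INR K).
Proof.
  induction K.
  - simpl INR. rewrite Rminus_0_r. simpl.
    assert (HA : forall s, 1 < Re s -> analytic_family (fun s q => ((s - 1) * hsum s q)%C) s).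
    { intros s Hs. apply analytic_family_mult_linear. now apply analytic_family_hsum. }
    assert (HD : forall s q, 1 < Re s -> 1 < q ->
      is_RC_derive (fun t => (s - 1) * hsum s t)%C q (- (s - 1) * ((s + 1 - 1) * hsum (s + 1) q))%C).
    { intros s q Hs Hq. eapply is_RC_derive_eq.
      - apply is_RC_derive_cmult, hsum_derive; trivial.
      - ring. }
    split; [trivial | split; trivial].
    intros s q Hs Hq. unfold continuation_step.
    assert (Hs1 : 1 < Re (s + 1)) by (rewrite Re_plus1; lra).
    assert (Hc : forall q, 1 < q -> RC_continuous (fun t => (s + 1 - 1) * hsum (s + 1) t)%C q).
    { intros t Ht. apply (analytic_family_continuous (fun s q => (s - 1) * hsum s q)%C); auto. }
    rewrite <- (prim_hsum_difference s q) by trivial.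
    assert (E := taylor_op_of_derivative (fun t => (s - 1) * hsum s t)%C
       (fun t => - (s - 1) * ((s + 1 - 1) * hsum (s + 1) t))%C q).
    rewrite taylor_op_cmult in E by trivial.
    (* For [h = (s - 1) * hsum s], this term is [h] minus the integral of [h] over the unit
       interval; the [negpow] term is that same integral, so [h] remains. *)
    assert (E' : ((s - 1) * taylor_op (fun q0 => (s + 1 - 1) * hsum (s + 1) q0) q)%C =
      (- (prim (fun t => (s - 1) * hsum s t) (q + 1) - prim (fun t => (s - 1) * hsum s t) q
          - (s - 1) * hsum s q))%C).
    { rewrite <- E; trivial.
      - ring.
      - intros t [Ht _]. now apply HD.
      - intros t Ht. apply RC_continuous_mult; [apply RC_continuous_const | auto]. }
    rewrite E'. ring.
  - replace (1 - INR (S K)) with (1 - INR K - 1) by (rewrite S_INR; ring).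
    now apply zeta_like_step.
Qed.

Lemma reg_zeta_upto_stable (K j : nat) (s : C) (q : R) :
  1 - INR K < Re s -> 1 < q -> reg_zeta_upto (K + j) s q = reg_zeta_upto K s q.
Proof.
  intros Hs Hq. induction j.
  - now rewrite Nat.add_0_r.
  - rewrite Nat.add_succ_r, <- IHj. apply (zeta_like_upto (K + j)); trivial.
    rewrite plus_INR. assert (P := pos_INR j). lra.
Qed.

(* [(s - 1) * zeta(s, q)] for [q > 1]. *)
Definition reg_zeta (s : C) (q : R) : C := reg_zeta_upto (Z.to_nat (up (1 - Re s))) s q.

Lemma reg_zeta_eq (K : nat) (s : C) (q : R) :
  1 - INR K < Re s -> 1 < q -> reg_zeta s q = reg_zeta_upto K s q.
Proof.
  intros Hs Hq. unfold reg_zeta. set (L := Z.to_nat (up (1 - Re s))).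
  assert (HL : 1 - INR L < Re s).
  (* [up] lies strictly above its argument, and [Z.to_nat] can only raise an integer, from negative
     to 0. *)
  { destruct (archimed (1 - Re s)) as [A _].
    assert (IZR (up (1 - Re s)) <= INR L); [|lra].
    rewrite INR_IZR_INZ. apply IZR_le. unfold L. lia. }
  destruct (Nat.le_ge_cases K L) as [H|H].
  - replace L with (K + (L - K))%nat by lia. now apply reg_zeta_upto_stable.
  - replace K with (L + (K - L))%nat by lia. symmetry. now apply reg_zeta_upto_stable.
Qed.

Lemma exists_INR_above (s : C) : exists K, 1 - INR K < Re s.
Proof. destruct (INR_unbounded (1 - Re s)) as [K HK]. exists K. lra. Qed.

Lemma reg_zeta_analytic (s : C) : analytic_family reg_zeta s.
Proof.
  destruct (exists_INR_above s) as [K HK].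
  apply (analytic_family_ext (reg_zeta_upto K) _ _ (1 - INR K)); trivial.
  - intros; symmetry; now apply reg_zeta_eq.
  - now apply zeta_like_upto.
Qed.

Lemma reg_zeta_derive (s : C) (q : R) :
  1 < q -> is_RC_derive (reg_zeta s) q (- (s - 1) * reg_zeta (s + 1) q)%C.
Proof.
  intros Hq. destruct (exists_INR_above s) as [K HK].
  apply (is_RC_derive_ext_loc (reg_zeta_upto K s)).
  - generalize (open_gt 1 q Hq). apply filter_imp. intros t Ht. symmetry. now apply reg_zeta_eq.
  - rewrite (reg_zeta_eq K (s + 1)); trivial.
    + now apply zeta_like_upto.
    + rewrite Re_plus1; lra.
Qed.

(** One continuation step reaches [s = 1], where the factor [s - 1] kills the integral and [q^0]
    remains. This value is the residue of zeta. *)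
Lemma reg_zeta_1 (q : R) : 1 < q -> reg_zeta 1 q = 1%C.
Proof.
  intros Hq. rewrite (reg_zeta_eq 1); trivial.
  - simpl. unfold continuation_step. replace (1 - 1)%C with (RtoC 0) by ring.
    rewrite negpow_0. ring.
  - simpl. lra.
Qed.

Lemma reg_zeta_half_plane (s : C) (q : R) :
  1 < Re s -> 1 < q -> reg_zeta s q = ((s - 1) * hsum s q)%C.
Proof. intros Hs Hq. rewrite (reg_zeta_eq 0); trivial. simpl; lra. Qed.

(** * Uniqueness of the continuation and the derivative in the parameter *)

Lemma Cminus_eq_0 (u v : C) : (u - v)%C = 0%C -> u = v.
Proof. intros H. replace u with ((u - v) + v)%C by ring. rewrite H; ring. Qed.

(** Analyticity at a point with explicit coefficient bounds; the two conversions with [analytic_at]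
    are proved below. *)
Definition has_disc_series (F : C -> C) (s0 : C) : Prop :=
  exists rho c M, 0 < rho /\ disc_series F s0 c rho M.

Lemma has_disc_series_plus (F G : C -> C) (s0 : C) :
  has_disc_series F s0 -> has_disc_series G s0 -> has_disc_series (fun s => F s + G s)%C s0.
Proof.
  intros (r1 & c1 & M1 & Hr1 & H1) (r2 & c2 & M2 & Hr2 & H2).
  assert (P : 0 < Rmin r1 r2) by now apply Rmin_glb_lt.
  assert (P1 := Rmin_l r1 r2). assert (P2 := Rmin_r r1 r2).
  exists (Rmin r1 r2), (fun k => c1 k + c2 k)%C, (M1 + M2). split; trivial.
  apply disc_series_plus; [apply disc_series_shrink with r1 | apply disc_series_shrink with r2]; auto.
Qed.

Lemma has_disc_series_cmult (a : C) (F : C -> C) (s0 : C) :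
  has_disc_series F s0 -> has_disc_series (fun s => a * F s)%C s0.
Proof.
  intros (r & c & M & Hr & H). do 3 eexists. split; [apply Hr|]. eapply disc_series_cmult, H.
Qed.

Lemma has_disc_series_mult_linear (a : C) (F : C -> C) (s0 : C) :
  has_disc_series F s0 -> has_disc_series (fun s => (s - a) * F s)%C s0.
Proof.
  intros (r & c & M & Hr & H). do 3 eexists. split; [apply Hr|]. eapply disc_series_mult_linear, H; trivial.
Qed.

Lemma has_disc_series_ext (F G : C -> C) (s0 : C) :
  (forall s, F s = G s) -> has_disc_series F s0 -> has_disc_series G s0.
Proof.
  intros E (r & c & M & Hr & H). exists r, c, M. split; trivial.
  now apply (disc_series_ext F).
Qed.

Lemma has_disc_series_negpow (x : R) (s0 : C) : has_disc_series (fun s => negpow s x) s0.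
Proof.
  exists 1, (fun k => negpow_coef s0 k x), (Cmod (negpow s0 x) * exp (1 * Cmod (Clog (RtoC x)))).
  split; [lra|]. split.
  - intros k. apply negpow_coef_bound_gen; lra.
  - intros w _. apply negpow_series.
Qed.

Lemma has_disc_series_Csum_n (F : nat -> C -> C) (s0 : C) (N : nat) :
  (forall n, has_disc_series (F n) s0) -> has_disc_series (fun s => Csum_n (fun n => F n s) N) s0.
Proof.
  intros H. induction N.
  - apply (has_disc_series_ext (F O)); [intros; now rewrite sum_O | auto].
  - apply (has_disc_series_ext (fun s => Csum_n (fun n => F n s) N + F (S N) s)%C).
    + intros; now rewrite Csum_n_S.
    + now apply has_disc_series_plus.
Qed.

(** Coefficients of the quotient of the series [c] by [b + w], from comparing powers of [w]. *)
Fixpoint div_coef (b : C) (c : nat -> C) (k : nat) : C :=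
  match k with
  | O => (c O / b)%C
  | S j => ((c (S j) - div_coef b c j) / b)%C
  end.

Lemma Cmod_lt_sub (w b : C) : Cmod w < Cmod b -> (b + w)%C <> 0%C.
Proof.
  intros H E. assert (W : w = (- b)%C).
  { replace w with ((b + w) - b)%C by ring. rewrite E; ring. }
  rewrite W, Cmod_opp in H. lra.
Qed.

Lemma is_Cseries_disc_geom (c : nat -> C) (w : C) (rho M : R) :
  (forall k, Cmod (c k) <= M * (/ rho) ^ k) -> Cmod w < rho ->
  is_Cseries (fun k => c k * w ^ k)%C (Cseries (fun k => c k * w ^ k)%C).
Proof.
  intros Hc Hw. assert (P := Cmod_ge_0 w).
  apply (Cseries_correct _ (fun k => M * (Cmod w / rho) ^ k)).
  - intros k. rewrite Cmod_mult, Cmod_pow. unfold Rdiv. rewrite Rpow_mult_distr.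
    replace (M * (Cmod w ^ k * (/ rho) ^ k)) with (M * (/ rho) ^ k * Cmod w ^ k) by ring.
    apply Rmult_le_compat_r; auto. now apply pow_le.
  - apply ex_series_geom_scal. rewrite Rabs_pos_eq.
    + apply Rmult_lt_reg_r with rho; [lra|]. field_simplify; lra.
    + apply Rmult_le_pos; trivial. left; apply Rinv_0_lt_compat; lra.
Qed.

Lemma has_disc_series_div (a : C) (F : C -> C) (s0 : C) :
  s0 <> a -> has_disc_series F s0 -> has_disc_series (fun s => F s / (s - a))%C s0.
Proof.
  intros Ha (r & c & M & Hr & H). set (b := (s0 - a)%C).
  assert (Hb : b <> 0%C).
  { intros E. now apply Ha, Cminus_eq_0. }
  assert (Pb : 0 < Cmod b) by now apply Cmod_gt_0.
  (* Within half of [Cmod b] the recursion of [div_coef] contracts by [1 / 2], and [b + w] has no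
     zero. *)
  set (rho := Rmin r (Cmod b / 2)).
  assert (P : 0 < rho) by (apply Rmin_glb_lt; lra).
  assert (P1 : rho <= r) by apply Rmin_l. assert (P2 : rho <= Cmod b / 2) by apply Rmin_r.
  apply (disc_series_shrink _ _ _ _ rho) in H; [|lra].
  assert (HM := disc_series_bound_nonneg _ _ _ _ _ H).
  (* [N] is the fixed point of the recursive bound: [(M + N * (Cmod b / 2)) / Cmod b = N]. *)
  destruct H as [H1 H2]. set (N := 2 * M / Cmod b).
  assert (HN : forall k, Cmod (div_coef b c k) <= N * (/ rho) ^ k).
  { induction k.
    - simpl. rewrite Cmod_div by trivial. specialize (H1 O). simpl in H1.
      unfold N. apply Rmult_le_reg_r with (Cmod b); trivial. field_simplify; lra.
    - simpl div_coef. rewrite Cmod_div by trivial.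
      apply Rmult_le_reg_r with (Cmod b); trivial.
      unfold Rdiv at 1. rewrite Rmult_assoc, Rinv_l, Rmult_1_r by lra.
      unfold Cminus. apply Rle_trans with (1 := Cmod_triangle _ _). rewrite Cmod_opp.
      specialize (H1 (S k)).
      assert (Q : 0 < (/ rho) ^ S k) by (apply pow_lt, Rinv_0_lt_compat, P).
      assert (IH : N * (/ rho) ^ k = N * rho * (/ rho) ^ S k) by (simpl; field; lra).
      rewrite IH in IHk.
      apply Rle_trans with ((M + N * rho) * (/ rho) ^ S k); [lra|].
      replace (N * (/ rho) ^ S k * Cmod b) with (N * Cmod b * (/ rho) ^ S k) by ring.
      apply Rmult_le_compat_r; [lra|].
      replace (N * Cmod b) with (2 * M) by (unfold N; field; lra).
      assert (N * rho <= N * (Cmod b / 2)).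
      { apply Rmult_le_compat_l; trivial. unfold N.
        apply Rmult_le_pos; [lra | left; now apply Rinv_0_lt_compat]. }
      replace (N * (Cmod b / 2)) with M in H by (unfold N; field; lra). lra. }
  exists rho, (div_coef b c), N. split; trivial. split; trivial.
  intros w Hw. assert (HB := is_Cseries_disc_geom _ w rho N HN Hw).
  set (B := Cseries (fun k => div_coef b c k * w ^ k)%C) in *.
  (* The quotient series is multiplied back by [s - a]; the coefficients become those of [F], and
     uniqueness of the sum identifies the product. *)
  assert (D : disc_series (fun s => Cseries (fun k => div_coef b c k * (s - s0) ^ k)%C) s0 (div_coef b c) rho N).
  { split; trivial. intros v Hv.
    replace (s0 + v - s0)%C with v by ring. now apply (is_Cseries_disc_geom _ v rho N). }
  destruct (disc_series_mult_linear _ s0 a _ _ _ P D) as [_ D'].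
  specialize (D' w Hw). cbv beta in D'. replace (s0 + w - s0)%C with w in D' by ring. fold B b in D'.
  assert (E : ((s0 + w - a) * B)%C = F (s0 + w)%C).
  { apply (is_Cseries_unique _ _ _ D'). apply is_Cseries_ext with (2 := H2 w Hw).
    intros [|k]; simpl; field; trivial. }
  rewrite <- E. replace ((s0 + w - a) * B / (s0 + w - a))%C with B; trivial.
  field. replace (s0 + w - a)%C with (b + w)%C by (unfold b; ring). apply Cmod_lt_sub. lra.
Qed.

(** Within half the radius the terms after the first are dominated by a geometric series of ratio
    [1 / 2], which gives the factor 2. *)
Lemma disc_series_lipschitz (c : nat -> C) (w l : C) (rho M : R) :
  0 < rho -> (forall k, Cmod (c k) <= M * (/ rho) ^ k) -> Cmod w <= rho / 2 ->
  is_Cseries (fun k => c k * w ^ k)%C l -> Cmod (l - c O) <= 2 * M / rho * Cmod w.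
Proof.
  intros Hr Hc Hw Hl. assert (P := Cmod_ge_0 w).
  apply is_Cseries_incr_1 in Hl.
  replace (l - c O * w ^ 0)%C with (l - c O)%C in Hl by (simpl; ring).
  assert (M0 : 0 <= M). { specialize (Hc O). simpl in Hc. assert (A := Cmod_ge_0 (c O)). lra. }
  apply (Cmod_is_Cseries _ (fun k => M / rho * Cmod w * (/ 2) ^ k) _ _) with (2 := Hl).
  - intros k. rewrite Cmod_mult, Cmod_pow. simpl.
    apply Rle_trans with (M * (/ rho) ^ S k * (Cmod w * Cmod w ^ k)).
    { apply Rmult_le_compat_r; auto. apply Rmult_le_pos; trivial. now apply pow_le. }
    simpl. replace (M * (/ rho * (/ rho) ^ k) * (Cmod w * Cmod w ^ k))
      with (M / rho * Cmod w * ((/ rho) ^ k * Cmod w ^ k)) by (unfold Rdiv; ring).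
    assert (Q : 0 < / rho) by now apply Rinv_0_lt_compat.
    apply Rmult_le_compat_l.
    { repeat apply Rmult_le_pos; lra. }
    rewrite <- Rpow_mult_distr. apply pow_incr. split; [apply Rmult_le_pos; lra|].
    apply Rmult_le_reg_l with rho; trivial. rewrite <- Rmult_assoc, Rinv_r by lra. lra.
  - replace (2 * M / rho * Cmod w) with (M / rho * Cmod w * / (1 - / 2)) by (field; lra).
    apply (is_series_scal (K := R_AbsRing) (V := R_NormedModule)).
    apply is_series_geom. rewrite Rabs_pos_eq; lra.
Qed.

Lemma ball_of_Cmod (x y : C) (eps : R) : Cmod (y - x) < eps -> ball (M := C_UniformSpace) x eps y.
Proof. intros H. now apply C_NormedModule_mixin_compat1. Qed.

Lemma Cmod_of_ball (x y : C) (eps : posreal) :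
  ball (M := C_UniformSpace) x eps y -> Cmod (y - x) < 2 * eps.
Proof.
  intros H. apply C_NormedModule_mixin_compat2 in H.
  apply Rlt_le_trans with (1 := H).
  assert (Hsqrt := sqrt2_le_2).
  assert (P := cond_pos eps). nra.
Qed.

Lemma is_pseries_C (a : nat -> C) (w l : C) :
  is_pseries (K := C_AbsRing) (V := C_NormedModule) a w l <-> is_Cseries (fun k => a k * w ^ k)%C l.
Proof.
  split; intros H; apply is_Cseries_ext with (2 := H); intros k; apply Cmult_comm.
Qed.

Lemma has_disc_series_analytic (F : C -> C) (s0 : C) : has_disc_series F s0 -> analytic_at F s0.
Proof.
  intros (r & c & M & Hr & H1 & H2). exists c.
  assert (P : 0 < r / 2) by lra. exists (mkposreal _ P). intros z Hz.
  apply Cmod_of_ball in Hz. simpl in Hz. apply is_pseries_C.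
  replace (F z) with (F (s0 + (z - s0))%C) by (f_equal; ring). apply H2. lra.
Qed.

(** Convergence at the single point [s0 + rho] makes the terms [a k * rho ^ k] tend to 0, hence
    bounded, and this is the coefficient bound. *)
Lemma analytic_has_disc_series (F : C -> C) (s0 : C) : analytic_at F s0 -> has_disc_series F s0.
Proof.
  intros [a [eps H]].
  assert (P := cond_pos eps). set (rho := eps / 2). assert (Hr : 0 < rho) by (unfold rho; lra).
  assert (H' : forall w, Cmod w < eps -> is_Cseries (fun k => a k * w ^ k)%C (F (s0 + w)%C)).
  { intros w Hw. specialize (H (s0 + w)%C). replace (s0 + w - s0)%C with w in H by ring.
    refine (proj1 (is_pseries_C _ _ _) (H _)).
    apply ball_of_Cmod. now replace (s0 + w - s0)%C with w by ring. }
  exists rho, a.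
  assert (Hc : Cmod (RtoC rho) = rho) by (rewrite Cmod_R, Rabs_pos_eq; lra).
  assert (HS := H' (RtoC rho) ltac:(rewrite Hc; unfold rho; lra)).
  apply is_Cseries_iff in HS as [S1 S2].
  assert (L1 := ex_series_lim_0 _ (ex_intro _ _ S1)). assert (L2 := ex_series_lim_0 _ (ex_intro _ _ S2)).
  destruct (filterlim_bounded (K := R_AbsRing) (V := R_NormedModule) _ (ex_intro _ 0 L1)) as [M1 B1].
  destruct (filterlim_bounded (K := R_AbsRing) (V := R_NormedModule) _ (ex_intro _ 0 L2)) as [M2 B2].
  (* A modulus is at most [sqrt 2] times the larger component. *)
  exists (2 * (Rmax M1 M2)). split; trivial. split.
  - intros k. specialize (B1 k); specialize (B2 k).
    assert (Q : 0 < rho ^ k) by now apply pow_lt.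
    apply Rmult_le_reg_r with (rho ^ k); trivial.
    rewrite pow_inv, Rmult_assoc, Rinv_l, Rmult_1_r by lra.
    rewrite <- Hc at 1. rewrite <- Cmod_pow, <- Cmod_mult.
    apply Rle_trans with (1 := Cmod_2Rmax _).
    assert (Hsqrt := sqrt2_le_2).
    apply Rmult_le_compat; trivial; [apply sqrt_pos | | ].
    + apply Rle_trans with (2 := Rmax_l _ _). apply Rabs_pos.
    + apply Rmax_lub; [apply Rle_trans with (2 := Rmax_l _ _); exact B1
                      | apply Rle_trans with (2 := Rmax_r _ _); exact B2].
  - intros w Hw. apply H'. unfold rho in Hw. lra.
Qed.

(** * Vanishing along a segment and the identity theorem *)

Lemma RtoC_neq (x y : R) : x <> y -> RtoC x <> RtoC y.
Proof. intros H E. now apply H, RtoC_inj. Qed.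

(** Letting [t] tend to 0 kills the constant term; dividing by [RtoC t * d] shifts the coefficients,
    and induction applies to the shifted series, which is why [c] and [M] are quantified after
    [k]. *)
Lemma disc_coef_zero (d : C) (rho tau : R) (k : nat) :
  d <> 0%C -> 0 < rho -> 0 < tau -> forall (c : nat -> C) (M : R),
  (forall k, Cmod (c k) <= M * (/ rho) ^ k) ->
  (forall t, 0 < t < tau -> is_Cseries (fun k => c k * (RtoC t * d) ^ k)%C (RtoC 0)) ->
  c k = 0%C.
Proof.
  intros Hd Hr Ht. assert (Pd : 0 < Cmod d) by now apply Cmod_gt_0.
  assert (Z : forall (c : nat -> C) (M : R), (forall k, Cmod (c k) <= M * (/ rho) ^ k) ->
    (forall t, 0 < t < tau -> is_Cseries (fun k => c k * (RtoC t * d) ^ k)%C (RtoC 0)) -> c O = 0%C).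
  { intros c M Hc H0. apply Cmod_eq_0.
    destruct (Rle_lt_or_eq_dec _ _ (Cmod_ge_0 (c O))) as [Hlt|<-]; trivial. exfalso.
    assert (M0 : 0 <= M). { specialize (Hc O). simpl in Hc. lra. }
    set (D := 2 * M / rho * Cmod d).
    assert (D0 : 0 <= D).
    { unfold D. repeat apply Rmult_le_pos; try lra. left; now apply Rinv_0_lt_compat. }
    (* Small enough for the segment and for half the radius, and with [D * t <= Cmod (c O) / 2],
       against the Lipschitz bound [Cmod (c O) <= D * t]. *)
    set (t := Rmin (tau / 2) (Rmin (rho / 2 / Cmod d) (Cmod (c O) / 2 / (D + 1)))).
    assert (T1 : t <= tau / 2) by apply Rmin_l.
    assert (T2 : t <= rho / 2 / Cmod d) by (eapply Rle_trans; [apply Rmin_r | apply Rmin_l]).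
    assert (T3 : t <= Cmod (c O) / 2 / (D + 1)) by (eapply Rle_trans; [apply Rmin_r | apply Rmin_r]).
    assert (T0 : 0 < t).
    { unfold t. repeat apply Rmin_glb_lt; [lra | |]; apply Rdiv_lt_0_compat; lra. }
    assert (E : Cmod (RtoC t * d) = t * Cmod d) by (rewrite Cmod_mult, Cmod_R, Rabs_pos_eq; lra).
    assert (W : Cmod (RtoC t * d) <= rho / 2).
    { rewrite E. apply Rmult_le_compat_r with (r := Cmod d) in T2; [|lra].
      replace (rho / 2 / Cmod d * Cmod d) with (rho / 2) in T2 by (field; lra). lra. }
    assert (L := disc_series_lipschitz c (RtoC t * d) 0 rho M Hr Hc W (H0 t ltac:(lra))).
    replace (0 - c O)%C with (- c O)%C in L by ring. rewrite Cmod_opp, E in L.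
    replace (2 * M / rho * (t * Cmod d)) with (D * t) in L by (unfold D; ring).
    apply Rmult_le_compat_r with (r := D + 1) in T3; [|lra].
    replace (Cmod (c O) / 2 / (D + 1) * (D + 1)) with (Cmod (c O) / 2) in T3 by (field; lra).
    nra. }
  induction k; intros c M Hc H0.
  - exact (Z c M Hc H0).
  - assert (C0 := Z c M Hc H0).
    apply (IHk (fun k => c (S k)) (M * / rho)).
    + intros j. apply Rle_trans with (1 := Hc (S j)). right; simpl; ring.
    + intros t Ht'. specialize (H0 t Ht').
      assert (N : (RtoC t * d)%C <> 0%C).
      { apply Cmult_neq_0; trivial. apply RtoC_neq; lra. }
      apply is_Cseries_incr_1 in H0. rewrite C0 in H0.
      replace (0 - 0 * (RtoC t * d) ^ 0)%C with (RtoC 0) in H0 by (simpl; ring).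
      apply (is_Cseries_cmult (/ (RtoC t * d))) in H0. rewrite Cmult_0_r in H0.
      apply is_Cseries_ext with (2 := H0). intros j. simpl. field.
      split; trivial. apply RtoC_neq; lra.
Qed.

Lemma Cseries_zero_coef (c : nat -> C) (w l : C) :
  (forall k, c k = 0%C) -> is_Cseries (fun k => c k * w ^ k)%C l -> l = 0%C.
Proof.
  intros Hc H. apply (is_Cseries_unique _ _ _ H).
  apply is_Cseries_ext with (2 := is_Cseries_0). intros k. rewrite Hc; ring.
Qed.

(** Connectedness of the segment: the supremum [v0] of the parameters up to which [F] vanishes is
    the centre of a disc of zeros, so it cannot stop before 1. *)
Lemma identity_on_segment (F : C -> C) (p d : C) (eps : R) :
  0 < eps -> (forall w, Cmod w < eps -> F (p + w)%C = 0%C) ->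
  (forall v, 0 <= v <= 1 -> has_disc_series F (p + RtoC v * d)%C) ->
  F (p + d)%C = 0%C.
Proof.
  intros He H0 HF.
  destruct (excluded_middle_informative (d = 0%C)) as [->|Hd].
  { apply H0. now rewrite Cmod_0. }
  assert (Pd : 0 < Cmod d) by now apply Cmod_gt_0.
  pose (S := fun v => 0 <= v <= 1 /\ forall u, 0 <= u <= v -> F (p + RtoC u * d)%C = 0%C).
  assert (S0 : S 0).
  { split; [lra|]. intros u Hu. apply H0. replace u with 0 by lra. rewrite Cmult_0_l, Cmod_0; lra. }
  destruct (completeness S) as [v0 [Hub Hlub]].
  { exists 1. intros v [Hv _]; lra. }
  { now exists 0. }
  assert (V0 : 0 <= v0) by now apply Hub.
  assert (V1 : v0 <= 1) by (apply Hlub; intros v [Hv _]; lra).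
  assert (Below : forall u, 0 <= u < v0 -> F (p + RtoC u * d)%C = 0%C).
  { intros u Hu. apply NNPP. intros N. apply (Rlt_not_le v0 u); [lra|].
    apply Hlub. intros v [Hv Sv]. apply Rnot_lt_le. intros Huv. apply N, Sv. lra. }
  assert (Nbhd : exists r, 0 < r /\ forall w, Cmod w < r -> F (p + RtoC v0 * d + w)%C = 0%C).
  (* At [v0 = 0] the given disc around [p] serves. Otherwise [F] vanishes just before [v0], on a ray
     in direction [- d], which forces all coefficients at [v0] to be 0. *)
  { destruct (Rle_lt_or_eq_dec _ _ V0) as [Vpos|<-].
    2:{ exists eps. split; trivial. intros w Hw. rewrite Cmult_0_l, Cplus_0_r. auto. }
    destruct (HF v0) as (r & c & M & Hr & H1 & H2); [lra|]. exists r. split; trivial.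
    intros w Hw. refine (Cseries_zero_coef c w _ _ (H2 w Hw)). intros k.
    assert (Q : 0 < Rmin v0 (r / Cmod d)).
    { apply Rmin_glb_lt; trivial. now apply Rdiv_lt_0_compat. }
    assert (Hd' : (- d)%C <> 0%C).
    { intros E. apply Hd. replace d with (- - d)%C by ring. rewrite E; ring. }
    apply (disc_coef_zero (- d)%C r (Rmin v0 (r / Cmod d)) k Hd' Hr Q c M H1).
    intros t [Ht1 Ht2].
    assert (T1 := Rlt_le_trans _ _ _ Ht2 (Rmin_l _ _)). assert (T2 := Rlt_le_trans _ _ _ Ht2 (Rmin_r _ _)).
    replace (RtoC 0) with (F (p + RtoC v0 * d + RtoC t * - d)%C).
    - apply H2. rewrite Cmod_mult, Cmod_opp, Cmod_R, Rabs_pos_eq by lra.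
      apply Rmult_lt_compat_r with (r := Cmod d) in T2; trivial.
      replace (r / Cmod d * Cmod d) with r in T2 by (field; lra). trivial.
    - replace (p + RtoC v0 * d + RtoC t * - d)%C with (p + RtoC (v0 - t) * d)%C by (rewrite RtoC_minus; ring).
      apply Below. lra. }
  destruct Nbhd as [r [Hr HN]].
  assert (Full : forall u, 0 <= u -> u < v0 + r / Cmod d -> F (p + RtoC u * d)%C = 0%C).
  { intros u Hu1 Hu2. destruct (Rlt_le_dec u v0); [apply Below; lra|].
    replace (p + RtoC u * d)%C with (p + RtoC v0 * d + RtoC (u - v0) * d)%C by (rewrite RtoC_minus; ring).
    apply HN. rewrite Cmod_mult, Cmod_R, Rabs_pos_eq by lra.
    assert (T : u - v0 < r / Cmod d) by lra.
    apply Rmult_lt_compat_r with (r := Cmod d) in T; trivial.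
    replace (r / Cmod d * Cmod d) with r in T by (field; lra). trivial. }
  assert (Pr : 0 < r / Cmod d) by now apply Rdiv_lt_0_compat.
  replace (p + d)%C with (p + RtoC 1 * d)%C by ring. apply Full; [lra|].
  (* If the disc did not reach past 1, half of its reach [r / Cmod d] could be added to [v0] within
     [S]. *)
  destruct (Rle_lt_or_eq_dec _ _ V1) as [V|<-]; [|lra]. apply Rnot_le_lt. intros N.
  assert (v0 + r / Cmod d / 2 <= v0); [|lra].
  apply Hub. split; [lra|]. intros u Hu. apply Full; lra.
Qed.

Lemma identity_theorem (F : C -> C) (z : C) :
  (forall s, s <> RtoC 1 -> has_disc_series F s) ->
  (forall s, 1 < Re s -> F s = 0%C) -> z <> RtoC 1 -> F z = 0%C.
Proof.
  intros HF H0 Hz.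
  (* A non-real [z] is joined to [p] horizontally, off the real axis; a real [z] is joined to
     [2 + i], and the segment meets the real axis only at [z]. In both cases the unit disc around
     [p] lies in [Re s > 1]. *)
  pose (p := (2, if Req_EM_T (Im z) 0 then 1 else Im z) : C).
  replace z with (p + (z - p))%C by ring.
  apply identity_on_segment with 1; [lra | |].
  - intros w Hw. apply H0. assert (A := re_le_Cmod w). apply Rabs_le_between in A.
    unfold Re in *; simpl. lra.
  - intros v Hv. apply HF. intros E. apply (f_equal Im) in E as E2. apply (f_equal Re) in E as E1.
    unfold p in E1, E2. destruct z as [x y]. unfold Re, Im in E1, E2; simpl in E1, E2.
    destruct (Req_EM_T y 0) as [->|Hy].
    + apply Hz. replace v with 1 in E1 by lra. unfold RtoC. f_equal. lra.
    + apply Hy. lra.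
Qed.

Lemma is_hurwitz_zeta_unique (q : C) (Z1 Z2 : C -> C) (z : C) :
  is_hurwitz_zeta q Z1 -> is_hurwitz_zeta q Z2 -> z <> RtoC 1 -> Z1 z = Z2 z.
Proof.
  intros (A1 & B1 & _) (A2 & B2 & _) Hz.
  assert (E : (Z1 z + - (1) * Z2 z)%C = 0%C).
  { apply (identity_theorem (fun s => Z1 s + - (1) * Z2 s)%C); trivial.
    - intros s Hs. apply has_disc_series_plus; [|apply has_disc_series_cmult];
        apply analytic_has_disc_series; auto.
    - intros s Hs. rewrite (is_Cseries_unique _ _ _ (A1 s Hs) (A2 s Hs)). ring. }
  replace (Z1 z) with ((Z1 z + - (1) * Z2 z) + Z2 z)%C by ring. rewrite E; ring.
Qed.

(* The first [N + 1] terms are split off, so that the remaining parameter exceeds [1] even when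
   [x] is negative. *)
Definition shifted_zeta (N : nat) (s : C) (x : R) : C :=
  (Csum_n (fun n => negpow s (INR n + x)) N + reg_zeta s (INR (S N) + x) / (s - 1))%C.

Lemma has_disc_series_reg_zeta (q : R) (s : C) : 1 < q -> has_disc_series (fun s => reg_zeta s q) s.
Proof.
  intros Hq. destruct (reg_zeta_analytic s) as (r & c & Hr & _ & HB).
  destruct (HB (q + 1)) as [M HM]. exists r, (fun k => c k q), M. split; trivial. apply HM; lra.
Qed.

Lemma has_disc_series_continuous (F : C -> C) (s0 : C) :
  has_disc_series F s0 -> filterlim F (locally (T := C_UniformSpace) s0) (locally (T := C_UniformSpace) (F s0)).
Proof.
  intros (r & c & M & Hr & H). assert (M0 := disc_series_bound_nonneg _ _ _ _ _ H).
  destruct H as [H1 H2].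
  assert (E0 : F s0 = c O).
  { assert (A := H2 0 ltac:(rewrite Cmod_0; trivial)). rewrite Cplus_0_r in A.
    assert (L := disc_series_lipschitz c 0 _ r M Hr H1 ltac:(rewrite Cmod_0; lra) A).
    rewrite Cmod_0, Rmult_0_r in L.
    assert (E : (F s0 - c O)%C = 0%C) by (apply Cmod_eq_0, Rle_antisym; trivial; apply Cmod_ge_0).
    replace (F s0) with ((F s0 - c O) + c O)%C by ring. rewrite E; ring. }
  intros P [eps HP]. assert (Pe := cond_pos eps).
  set (D := 2 * M / r). assert (D0 : 0 <= D).
  { unfold D. apply Rmult_le_pos; [lra | left; now apply Rinv_0_lt_compat]. }
  set (t := Rmin (r / 2) (eps / (D + 1))).
  assert (T : 0 < t) by (apply Rmin_glb_lt; [lra | apply Rdiv_lt_0_compat; lra]).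
  assert (T1 : t <= r / 2) by apply Rmin_l. assert (T2 : t <= eps / (D + 1)) by apply Rmin_r.
  assert (T' : 0 < t / 2) by lra.
  exists (mkposreal _ T'). intros z Hz. apply Cmod_of_ball in Hz. simpl in Hz.
  apply HP, ball_of_Cmod. set (w := (z - s0)%C) in *.
  replace z with (s0 + w)%C by (unfold w; ring). rewrite E0.
  assert (L := disc_series_lipschitz c w _ r M Hr H1 ltac:(lra) (H2 w ltac:(lra))).
  fold D in L. apply Rle_lt_trans with (1 := L).
  apply Rmult_le_compat_r with (r := D + 1) in T2; [|lra].
  replace (eps / (D + 1) * (D + 1)) with (pos eps) in T2 by (field; lra).
  assert (Q := Cmod_ge_0 w). nra.
Qed.

Lemma shifted_zeta_correct (N : nat) (x : R) :
  0 < INR N + x -> is_hurwitz_zeta (RtoC x) (fun s => shifted_zeta N s x).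
Proof.
  intros Hx. assert (HS : 1 < INR (S N) + x) by (rewrite S_INR; lra).
  assert (HE := fun s => has_disc_series_reg_zeta _ s HS).
  assert (HP : forall s, has_disc_series (fun s => Csum_n (fun n => negpow s (INR n + x)) N) s).
  { intros s. apply (has_disc_series_Csum_n (fun n s => negpow s (INR n + x))).
    intros n. apply has_disc_series_negpow. }
  split; [|split].
  - intros z Hz. apply (is_Cseries_ext (fun n => negpow z (INR n + x))).
    { intros n. unfold negpow. now rewrite RtoC_plus. }
    unfold shifted_zeta. rewrite reg_zeta_half_plane by trivial.
    replace ((z - 1) * hsum z (INR (S N) + x) / (z - 1))%C with (hsum z (INR (S N) + x)).
    2:{ field. intros E. apply (f_equal Re) in E. unfold Re in *; simpl in E. lra. }
    apply (is_series_decr_n (K := C_AbsRing) (V := C_NormedModule) _ (S N)); [lia|]. simpl pred.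
    assert (E : forall u v : C, v = (u + v + - u)%C) by (intros; ring).
    refine (eq_ind _ (fun l => is_Cseries _ l) _ _ (E (Csum_n (fun n => negpow z (INR n + x)) N) _)).
    apply (is_Cseries_ext (fun k => negpow z (INR k + (INR (S N) + x)))).
    + intros k. f_equal. rewrite plus_INR. ring.
    + now apply hsum_correct.
  - intros z Hz. apply has_disc_series_analytic. unfold shifted_zeta.
    apply has_disc_series_plus; trivial. now apply has_disc_series_div.
  - exists (RtoC 1). split; [apply RtoC_neq; lra|].
    (* [G] is [s - 1] times [shifted_zeta] with the division cancelled, so it is continuous at 1,
       where only [reg_zeta] remains. *)
    pose (G := fun s => ((s - 1) * Csum_n (fun n => negpow s (INR n + x)) N + reg_zeta s (INR (S N) + x))%C).
    assert (HG : filterlim G (locally (T := C_UniformSpace) (RtoC 1)) (locally (T := C_UniformSpace) (G (RtoC 1)))).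
    { apply has_disc_series_continuous, has_disc_series_plus; trivial.
      now apply has_disc_series_mult_linear. }
    replace (G (RtoC 1)) with (RtoC 1) in HG.
    2:{ unfold G. rewrite reg_zeta_1 by trivial. ring. }
    apply (filterlim_ext_loc G).
    + exists (mkposreal 1 Rlt_0_1). intros s _ Hs. unfold G, shifted_zeta. field.
      intros E. now apply Hs, Cminus_eq_0.
    + intros P HP'. specialize (HG P HP'). destruct HG as [e He]. exists e. intros y Hy _. auto.
Qed.

(** [N] is left free so that one choice serves a neighbourhood of [x] and both [s] and [s + 1]. *)
Lemma hurwitz_zeta_eq (N : nat) (s : C) (x : R) :
  0 < INR N + x -> s <> RtoC 1 -> hurwitz_zeta s (RtoC x) = shifted_zeta N s x.
Proof.
  intros Hx Hs. assert (H := shifted_zeta_correct N x Hx).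
  apply (is_hurwitz_zeta_unique (RtoC x) (fun s => hurwitz_zeta s (RtoC x)) (fun s => shifted_zeta N s x)); trivial.
  unfold hurwitz_zeta. apply epsilon_spec. now exists (fun s => shifted_zeta N s x).
Qed.

Lemma shifted_zeta_derive (N : nat) (s : C) (x : R) :
  0 < INR N + x -> (forall n, x <> - INR n) ->
  is_RC_derive (shifted_zeta N s) x
    (- s * Csum_n (fun n => negpow (s + 1) (INR n + x)) N
     - (s - 1) * reg_zeta (s + 1) (INR (S N) + x) / (s - 1))%C.
Proof.
  intros HN Hx. eapply is_RC_derive_eq.
  - apply is_RC_derive_plus.
    + apply (RC_derive_Csum_n (fun n t => negpow s (INR n + t)) (fun n t => - s * negpow (s + 1) (INR n + t))%C).
      intros n.
      apply (is_RC_derive_ext (fun t => negpow s (INR n + 1 * t))).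
      { intros t. now rewrite Rmult_1_l. }
      eapply is_RC_derive_eq.
      * apply is_RC_derive_comp_affine, negpow_derive. specialize (Hx n). lra.
      * rewrite Rmult_1_l. ring.
    + apply is_RC_derive_mult; [|apply is_RC_derive_const].
      apply (is_RC_derive_ext (fun t => reg_zeta s (INR (S N) + 1 * t))).
      { intros t. now rewrite Rmult_1_l. }
      apply is_RC_derive_comp_affine, reg_zeta_derive. rewrite S_INR. lra.
  - rewrite Rmult_1_l.
    assert (E : Csum_n (fun n => - s * negpow (s + 1) (INR n + x))%C N =
                (- s * Csum_n (fun n => negpow (s + 1) (INR n + x)) N)%C :> C).
    { apply (sum_n_mult_l (K := C_Ring)). }
    rewrite E. unfold Cdiv. ring.
Qed.

Lemma shifted_zeta_locally (s : C) (x : R) :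
  s <> RtoC 1 -> exists N, 0 < INR N + x /\
    locally x (fun t => shifted_zeta N s t = hurwitz_zeta s (RtoC t)).
Proof.
  intros Hs. destruct (INR_unbounded (- x)) as [N HN]. exists N. split; [lra|].
  generalize (open_gt (- INR N) x ltac:(lra)). apply filter_imp. intros t Ht.
  symmetry. apply hurwitz_zeta_eq; trivial. lra.
Qed.

Lemma hurwitz_zeta_continuous (s : C) (x : R) :
  s <> RtoC 1 -> (forall n, x <> - INR n) ->
  RC_continuous (fun t => hurwitz_zeta s (RtoC t)) x.
Proof.
  intros Hs Hx. destruct (shifted_zeta_locally s x Hs) as (N & HN & HL).
  eapply is_RC_derive_continuous.
  apply (is_RC_derive_ext_loc (shifted_zeta N s)); [exact HL|].
  now apply shifted_zeta_derive.
Qed.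

(** At [s = 0] the right-hand side would contain the arbitrary value of [hurwitz_zeta] at its
    pole. *)
Lemma hurwitz_zeta_derive (s : C) (x : R) :
  s <> RtoC 1 -> s <> RtoC 0 -> (forall n, x <> - INR n) ->
  is_RC_derive (fun t => hurwitz_zeta s (RtoC t)) x (- s * hurwitz_zeta (s + 1) (RtoC x))%C.
Proof.
  intros Hs1 Hs0 Hx. destruct (shifted_zeta_locally s x Hs1) as (N & HN & HL).
  eapply is_RC_derive_eq.
  - apply (is_RC_derive_ext_loc (shifted_zeta N s)); [exact HL|].
    now apply shifted_zeta_derive.
  - rewrite (hurwitz_zeta_eq N); trivial.
    + unfold shifted_zeta. replace (s + 1 - 1)%C with s by ring. field.
      split; trivial. intros E. now apply Hs1, Cminus_eq_0.
    + intros E. apply Hs0. replace s with ((s + 1) - 1)%C by ring. rewrite E; ring.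
Qed.

(** * Integration by parts *)

Lemma RC_derive_n_correct (lo hi : Rbar) (r j : nat) (f : R -> C) (q : R) :
  times_differentiable_on lo hi r f -> (j < r)%nat -> in_open_interval lo hi q ->
  is_RC_derive (RC_derive_n f j) q (RC_derive_n f (S j) q).
Proof.
  intros Hf Hj Hq. destruct (Hf j Hj q Hq) as [l Hl].
  eapply is_RC_derive_eq; [exact Hl|].
  apply is_RC_derive_iff in Hl as [H1 H2].
  apply C_ext; simpl; symmetry; now apply is_derive_unique.
Qed.

Lemma exists_primitive (lo hi : Rbar) (g : R -> C) :
  (forall q, in_open_interval lo hi q -> RC_continuous g q) ->
  exists F, is_primitive_on lo hi F g.
Proof.
  (* [lo] and [hi] may bound an empty interval, on which every function is a primitive. *)
  intros Hg. destruct (classic (exists q0, in_open_interval lo hi q0)) as [[q0 H0]|N].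
  - exists (RC_prim q0 g). now apply RC_prim_correct.
  - exists g. intros q Hq. exfalso; eauto.
Qed.

Lemma primitive_difference (lo hi : Rbar) (F G g : R -> C) :
  is_primitive_on lo hi F g -> is_primitive_on lo hi G g ->
  exists c, forall q, in_open_interval lo hi q -> F q = (G q + c)%C.
Proof.
  intros HF HG. destruct (classic (exists q0, in_open_interval lo hi q0)) as [[q0 H0]|N].
  - exists (F q0 - G q0)%C. intros q Hq.
    assert (E := primitive_unique _ _ _ _ _ _ _ HF HG H0 Hq).
    replace (F q) with (F q - F q0 + F q0)%C by ring. rewrite E; ring.
  - exists 0%C. intros q Hq. exfalso; eauto.
Qed.

Lemma pochhammer_neq_0 (z : C) (k : nat) :
  (forall j, (1 <= j <= k)%nat -> z <> RtoC (INR j)) -> pochhammer (1 - z) k <> 0%C.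
Proof.
  intros Hz. induction k.
  - apply RtoC_neq; lra.
  - apply Cmult_neq_0.
    + apply IHk. intros; apply Hz; lia.
    + intros E. apply (Hz (S k)); [lia|]. rewrite S_INR, RtoC_plus.
      symmetry. apply Cminus_eq_0. rewrite <- E; ring.
Qed.

Lemma sum_telescope (W : nat -> C) (r : nat) :
  (1 <= r)%nat ->
  sum_n_m (G := C_AbelianGroup) (fun k => W (k - 1)%nat - W k)%C 1 r = (W O - W r)%C.
Proof.
  intros Hr. induction r; [lia|]. destruct r.
  - now rewrite sum_n_n.
  - rewrite sum_n_Sm, IHr by lia. change plus with Cplus.
    replace (S (S r) - 1)%nat with (S r) by lia.
    match goal with |- @eq _ ?x ?y => change (@eq C x y) end. ring.
Qed.

Lemma is_RC_derive_sum_n_m (u du : nat -> R -> C) (q : R) (r : nat) :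
  (1 <= r)%nat ->
  (forall k, (1 <= k <= r)%nat -> is_RC_derive (u k) q (du k q)) ->
  is_RC_derive (fun t => sum_n_m (G := C_AbelianGroup) (fun k => u k t) 1 r) q
    (sum_n_m (G := C_AbelianGroup) (fun k => du k q) 1 r).
Proof.
  intros Hr H. induction r; [lia|]. destruct r.
  - rewrite sum_n_n.
    apply (is_RC_derive_ext (u 1%nat)).
    + intros t. now rewrite sum_n_n.
    + apply H; lia.
  - rewrite sum_n_Sm by lia.
    apply (is_RC_derive_ext (fun t => sum_n_m (G := C_AbelianGroup) (fun k => u k t) 1 (S r) + u (S (S r)) t)%C).
    + intros t. now rewrite (sum_n_Sm _ 1 (S r)) by lia.
    + apply is_RC_derive_plus.
      * apply IHr; [lia|]. intros; apply H; lia.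
      * apply H; lia.
Qed.

(** The excluded values of [z] are the zeros [1, ..., r] of the Pochhammer symbols and the points
    [k + 1] where [z - k] hits the pole, which adds [r + 1]. Existence of both primitives is part of
    the conclusion, so that the identity is not vacuous. *)
Theorem theorem2p1 :
  forall (r : nat) (f : R -> C) (a b : R) (z : C) (lo hi : Rbar),
  (1 <= r)%nat ->
  b <> 0 ->
  (forall k : nat, (1 <= k <= r + 1)%nat -> z <> RtoC (INR k)) ->
  (forall q : R, in_open_interval lo hi q -> forall n : nat, a + b * q <> - INR n) ->
  times_differentiable_on lo hi r f ->
  let lhs_integrand := fun q : R =>
    (f q * hurwitz_zeta z (RtoC (a + b * q)))%C in
  let rhs_integrand := fun q : R =>
    (RC_derive_n f r q * hurwitz_zeta (z - RtoC (INR r)) (RtoC (a + b * q)))%C in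
  (exists F : R -> C, is_primitive_on lo hi F lhs_integrand) /\
  (exists G : R -> C, is_primitive_on lo hi G rhs_integrand) /\
  (forall F G : R -> C,
     is_primitive_on lo hi F lhs_integrand ->
     is_primitive_on lo hi G rhs_integrand ->
     exists c : C, forall q : R, in_open_interval lo hi q ->
       F q =
       (sum_n_m (G := C_AbelianGroup)
          (fun k : nat =>
             (RtoC (-1) ^ (k + 1)
              * (RC_derive_n f (k - 1) q
                 * hurwitz_zeta (z - RtoC (INR k)) (RtoC (a + b * q)))
              / (RtoC b ^ k * pochhammer (1 - z) k))%C) 1 r
        + RtoC (-1) ^ r / (RtoC b ^ r * pochhammer (1 - z) r) * G q
        + c)%C).
Proof.
  intros r f a b z lo hi Hr Hb Hz Hq Hf lhs rhs.
  set (zt := fun (k : nat) (q : R) => hurwitz_zeta (z - RtoC (INR k)) (RtoC (a + b * q))).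
  set (T := fun (k : nat) (q : R) => (RtoC (-1) ^ (k + 1) * (RC_derive_n f (k - 1) q * zt k q)
              / (RtoC b ^ k * pochhammer (1 - z) k))%C).
  (* The integrand left after [k] integrations by parts, coefficient included: [W 0] is [lhs], [W r]
     is [cr * rhs], and [T k] has derivative [W (k - 1) - W k], so the sum telescopes. *)
  set (W := fun (k : nat) (q : R) => (RtoC (-1) ^ k / (RtoC b ^ k * pochhammer (1 - z) k)
              * (RC_derive_n f k q * zt k q))%C).
  set (cr := (RtoC (-1) ^ r / (RtoC b ^ r * pochhammer (1 - z) r))%C).
  assert (Hm1 : RtoC (-1) = (- (1))%C) by (apply C_ext; simpl; ring).
  assert (Hbk : forall k, (RtoC b ^ k)%C <> 0%C).
  { intros k. apply Cpow_nz. now apply RtoC_neq. }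
  assert (HP : forall k, (k <= r)%nat -> pochhammer (1 - z) k <> 0%C).
  { intros k Hk. apply pochhammer_neq_0. intros; apply Hz; lia. }
  assert (Hcr : cr <> 0%C).
  { apply Cmult_neq_0.
    - apply Cpow_nz, RtoC_neq; lra.
    - intros E. assert (D : (RtoC b ^ r * pochhammer (1 - z) r)%C <> 0%C) by (apply Cmult_neq_0; auto).
      apply (RtoC_neq 1 0); [lra|]. rewrite <- (Cinv_r _ D), E. ring. }
  assert (Hzt : forall k q, (1 <= k <= r)%nat -> in_open_interval lo hi q ->
    is_RC_derive (zt k) q (RtoC b * (- (z - RtoC (INR k)) * zt (k - 1)%nat q))%C).
  { intros k q Hk Hi. unfold zt.
    replace (z - RtoC (INR (k - 1)))%C with (z - RtoC (INR k) + 1)%C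
      by (rewrite minus_INR by lia; rewrite RtoC_minus; simpl; ring).
    apply (is_RC_derive_comp_affine (fun t => hurwitz_zeta (z - RtoC (INR k)) (RtoC t))).
    apply hurwitz_zeta_derive; [| | now apply Hq].
    (* [z - k] must differ from the pole 1, which for [k = r] uses the index [r + 1], and from 0,
       whose successor is the pole. *)
    - intros E. apply (Hz (S k)); [lia|]. rewrite S_INR, RtoC_plus, <- E. ring.
    - intros E. apply (Hz k); [lia|]. now apply Cminus_eq_0. }
  assert (HT : forall k q, (1 <= k <= r)%nat -> in_open_interval lo hi q ->
    is_RC_derive (T k) q (W (k - 1)%nat q - W k q)%C).
  { intros k q Hk Hi. destruct k as [|j]; [lia|].
    unfold T, W. replace (S j - 1)%nat with j by lia.
    apply (is_RC_derive_ext (fun t => RtoC (-1) ^ (S j + 1) / (RtoC b ^ S j * pochhammer (1 - z) (S j))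
                                      * (RC_derive_n f j t * zt (S j) t))%C).
    { intros t. unfold Cdiv. ring. }
    eapply is_RC_derive_eq.
    - apply is_RC_derive_cmult, is_RC_derive_mult.
      + apply (RC_derive_n_correct lo hi r); trivial; lia.
      + apply Hzt; trivial.
    (* The inner factor [- (z - (j + 1))] is [1 - z + j], the last factor of the Pochhammer symbol
       at [S j]; it cancels and leaves the coefficient of [W j]. *)
    - replace (S j - 1)%nat with j by lia.
      assert (P1 := HP (S j) ltac:(lia)). assert (P0 := HP j ltac:(lia)). assert (B := Hbk j).
      assert (B1 : RtoC b <> 0%C) by now apply RtoC_neq.
      replace (S j + 1)%nat with (S (S j)) by lia.
      simpl pochhammer in *. simpl Cpow. rewrite Hm1, S_INR, RtoC_plus.
      assert (N : (1 - z + RtoC (INR j))%C <> 0%C).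
      { intros E. apply P1. rewrite E. ring. }
      field. repeat split; trivial. }
  set (Sg := fun q => sum_n_m (G := C_AbelianGroup) (fun k => T k q) 1 r).
  assert (HS : is_primitive_on lo hi Sg (fun q => lhs q - cr * rhs q)%C).
  { intros q Hi. eapply is_RC_derive_eq.
    - apply (is_RC_derive_sum_n_m T (fun k q => W (k - 1)%nat q - W k q)%C); auto.
    - rewrite (sum_telescope (fun k => W k q)) by trivial.
      unfold W, lhs, rhs, cr, zt. simpl.
      replace (z - 0)%C with z by ring. field. split; auto. }
  assert (HF : exists F, is_primitive_on lo hi F lhs).
  { apply exists_primitive. intros q Hi. apply RC_continuous_mult.
    - eapply is_RC_derive_continuous.
      apply (RC_derive_n_correct lo hi r 0 f q); trivial; lia.
    - assert (C0 : RC_continuous (fun t => hurwitz_zeta z (RtoC t)) (a + b * q)).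
      { apply hurwitz_zeta_continuous; [|now apply Hq].
        apply (Hz 1%nat); lia. }
      assert (Ca : continuous (fun t : R => a + b * t) q).
      { apply (is_derive_Rcontinuous _ _ b). auto_derive; trivial; ring. }
      destruct C0 as [C1 C2].
      split; [exact (continuous_comp _ (fun t => Re (hurwitz_zeta z (RtoC t))) q Ca C1)
             | exact (continuous_comp _ (fun t => Im (hurwitz_zeta z (RtoC t))) q Ca C2)]. }
  split; [trivial | split].
  (* [RC_derive_n f r] need not be continuous, so the identity is solved for the second primitive,
     by means of [cr <> 0]. *)
  - destruct HF as [F HF]. exists (fun q => / cr * (F q - Sg q))%C. intros q Hi.
    eapply is_RC_derive_eq.
    + apply is_RC_derive_cmult, is_RC_derive_minus; auto.
    + change (/ cr * (lhs q - (lhs q - cr * rhs q)) = rhs q)%C. field; trivial.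
  - intros F G HF' HG.
    apply (primitive_difference lo hi F (fun q => Sg q + cr * G q)%C lhs); trivial.
    intros q Hi. eapply is_RC_derive_eq.
    + apply is_RC_derive_plus; [auto | apply is_RC_derive_cmult; auto].
    + ring.
Qed.
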